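(* Let $A$ be a Hopf $*$-algebra, $B\subseteq A$ a quantum homogeneous space which is a $*$-subalgebra, and $\Omega^\bullet\in{}^A_B\mathrm{mod}_0$ a covariant differential $*$-calculus over $B$. For any positive definite covariant Hermitian structure $(\Omega^{(\bullet,\bullet)},\sigma)$ on $\Omega^\bullet$, an Hermitian module is given by the pair $(\Omega^\bullet,h_\sigma)$, where $$h_\sigma:\overline{\Omega^\bullet}\to{}^\vee(\Omega^\bullet),\qquad \overline{\omega}\mapsto g_\sigma(-,\omega).$$
   Context: Algebras are unital over $\mathbb{C}$; $A$ has coproduct $\Delta$, counit $\epsilon$, antipode $S$. **Quantum homogeneous spaces.** A left coideal subalgebra $B\subseteq A$ is a quantum homogeneous $A$-space if $A$ is faithfully flat as a right $B$-module and $B^+A=AB^+$, $B^+=B\cap\ker\epsilon$. Let $\pi_B(A)=A/B^+A$. ${}^A_B\mathrm{mod}$ is the category of left $A$-comodules $\mathcal{F}$ (coaction $\Delta_L(f)=f_{(-1)}\otimes f_{(0)}$) with a finitely generated left $B$-module structure such that $\Delta_L(bf)=\Delta(b)\Delta_L(f)$. Put $\Phi(\mathcal{F})=\mathcal{F}/B^+\mathcal{F}$, a left $\pi_B(A)$-comodule; by Takeuchi, $\Phi$ is an equivalence onto finite-dimensional left $\pi_B(A)$-comodules with inverse $V\mapsto A\square_{\pi_B}V$ and unit $f\mapsto f_{(-1)}\otimes[f_{(0)}]$. ${}^A_B\mathrm{mod}_0$ has the same objects, regarded as $B$-bimodules with right action $fb=f_{(-2)}bS(f_{(-1)})f_{(0)}$,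 i.e. right multiplication on the first factor of $A\square_{\pi_B}\Phi(\mathcal{F})$. **Calculi.** A differential calculus over $B$ is a dg-algebra $(\Omega^\bullet,\mathrm{d})$ with $\Omega^0=B$, generated as an algebra by $a,\mathrm{d}b$ ($a,b\in B$). It has total degree $m$ if $\Omega^m\neq0$, $\Omega^k=0$ for $k>m$. It is covariant if $\Delta:B\to A\otimes B$ extends to a left $A$-comodule algebra structure on $\Omega^\bullet$ for which $\mathrm{d}$ is a comodule map. It is a $*$-calculus if $*$ extends to a conjugate-linear involution with $\mathrm{d}(\omega^* )=(\mathrm{d}\omega)^*$ and $(\omega\wedge\nu)^*=(-1)^{kl}\nu^*\wedge\omega^*$ for $\omega\in\Omega^k,\nu\in\Omega^l$. A complex structure is an $\mathbb{Z}_{\ge0}^2$-algebra grading $\Omega^{(\bullet,\bullet)}$ with $\Omega^k=\bigoplus_{a+b=k}\Omega^{(a,b)}$, $(\Omega^{(a,b)})^*=\Omega^{(b,a)}$, $\mathrm{d}=\partial+\overline{\partial}$ with $\partial,\overline{\partial}$ of degrees $(1,0),(0,1)$; it is covariant if each $\Omega^{(a,b)}$ is a subcomodule. **Hermitian structures.** For $\Omega^\bullet$ of total degree $2n$, an Hermitian structure is a pair $(\Omega^{(\bullet,\bullet)},\sigma)$ of a complex structure and a central real ($\sigma^*=\sigma$) $(1,1)$-form $\sigma$ such that, for $L(\omega)=\sigma\wedge\omega$, the maps $L^{n-k}:\Omega^k\to\Omega^{2n-k}$ are isomorphisms for $k=0,\dots,n-1$. It is covariant if the complex structure is covariant and $\Delta_L(\sigma)=1\otimes\sigma$.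 With $P^{(a,b)}=\{\alpha\in\Omega^{(a,b)}:L^{n-a-b+1}\alpha=0\}$, $a+b\le n$, the Hodge map $\ast_\sigma$ is the linear map with $\ast_\sigma(L^j\alpha)=(-1)^{k(k+1)/2}\mathbf{i}^{a-b}\frac{j!}{(n-j-k)!}L^{n-j-k}\alpha$ for $\alpha\in P^{(a,b)}$, $k=a+b$, $0\le j\le n-k$ (these $L^j\alpha$ span $\Omega^\bullet$). The metric is $g_\sigma(\omega,\nu)=\ast_\sigma(\omega\wedge\ast_\sigma(\nu^* ))\in B$ for forms of equal degree and $0$ otherwise. Let $B_{>0}$ be the set of non-zero finite sums $\sum\lambda_ib_i^*b_i$, $\lambda_i>0$, $b_i\in B$. Positive definite means $g_\sigma(\omega,\omega)\in B_{>0}$ for all $\omega\neq0$. **Hermitian modules.** For a finitely generated projective left $B$-module $\mathcal{F}$, ${}^\vee\mathcal{F}={}_B\mathrm{Hom}(\mathcal{F},B)$ with $(\phi b)(f)=\phi(f)b$, and $\overline{\mathcal{F}}$ is the conjugate right module, $\overline{f}b=\overline{b^*f}$. An Hermitian module is a pair $(\mathcal{F},h)$ with $h:\overline{\mathcal{F}}\to{}^\vee\mathcal{F}$ a right $B$-module isomorphism such that $h(f,k):=h(\overline{k})(f)$ satisfies $h(f,k)=h(k,f)^*$ and $h(f,f)\in B_{>0}$ for $f\ne0$. *)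

(* Defs.v *)
From HB Require Import structures.
From mathcomp Require Import all_boot all_order all_algebra generic_quotient.
From mathcomp Require Import complex.
From mathcomp Require Import mathcomp_extra boolp classical_sets functions.
From mathcomp Require Import cardinality fsbigop reals.

Set Implicit Arguments.
Unset Strict Implicit.
Unset Printing Implicit Defensive.

Import Order.TTheory GRing.Theory Num.Theory.

Local Open Scope ring_scope.
Local Open Scope classical_set_scope.
Local Open Scope quotient_scope.
Local Open Scope complex_scope.

Reserved Notation "v ⊗ w" (at level 40, left associativity).

(* M ⊗_K N for an abelian group M with a right action of K and an abelian     *)
(* group N with a left action of K: formal finite sums of pairs, two of them  *)
(* being identified when every biadditive K-balanced map to an abelian group  *)
(* takes the same value on both.                                              *)

Section BalancedTensor.
Context {K : Type} {M N : zmodType} (ra : M -> K -> M) (la : K -> N -> N).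

Definition balanced (Z : zmodType) (beta : M -> N -> Z) : Prop :=
  [/\ forall m m' n, beta (m + m') n = beta m n + beta m' n,
      forall m n n', beta m (n + n') = beta m n + beta m n'
    & forall m k n, beta (ra m k) n = beta m (la k n)].

Definition evalsum (Z : zmodType) (beta : M -> N -> Z) (s : seq (M * N)) : Z :=
  \sum_(p <- s) beta p.1 p.2.

Definition tensor_eqP (s t : seq (M * N)) : Prop :=
  forall (Z : zmodType) (beta : M -> N -> Z),
    balanced beta -> evalsum beta s = evalsum beta t.

Definition tensor_eq (s t : seq (M * N)) : bool := `[< tensor_eqP s t >].

Lemma tensor_eq_refl : reflexive tensor_eq.
Proof. by move=> s; apply/asboolP. Qed.

Lemma tensor_eq_sym : symmetric tensor_eq.
Proof.
by move=> s t; apply/idP/idP => /asboolP h; apply/asboolP => Z beta hb;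
  rewrite (h Z beta hb).
Qed.

Lemma tensor_eq_trans : transitive tensor_eq.
Proof.
move=> t s u /asboolP h1 /asboolP h2; apply/asboolP => Z beta hb.
by rewrite (h1 Z beta hb) (h2 Z beta hb).
Qed.

Canonical tensor_equiv := EquivRel tensor_eq
  tensor_eq_refl tensor_eq_sym tensor_eq_trans.

Definition btensor := {eq_quot tensor_equiv}.

HB.instance Definition _ := Choice.on btensor.

Definition bclass (s : seq (M * N)) : btensor := \pi_({eq_quot tensor_equiv}) s.

Definition btens (m : M) (n : N) : btensor := bclass [:: (m, n)].

Definition blift (Z : zmodType) (beta : M -> N -> Z) (x : btensor) : Z :=
  evalsum beta (repr (x : {eq_quot tensor_equiv})).

Lemma bclass_eq s t : tensor_eqP s t -> bclass s = bclass t.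
Proof. by move=> h; apply/eqmodP/asboolP. Qed.

Lemma bclass_repr (x : btensor) : bclass (repr (x : {eq_quot tensor_equiv})) = x.
Proof. exact: reprK. Qed.

Lemma blift_class (Z : zmodType) (beta : M -> N -> Z) s :
  balanced beta -> blift beta (bclass s) = evalsum beta s.
Proof.
move=> hb; rewrite /blift /bclass.
have /eqmodP/asboolP h : repr (\pi_({eq_quot tensor_equiv}) s) = s
  %[mod {eq_quot tensor_equiv}] by rewrite reprK.
exact: h.
Qed.

Lemma bliftE (Z : zmodType) (beta : M -> N -> Z) m n :
  balanced beta -> blift beta (btens m n) = beta m n.
Proof. by move=> hb; rewrite blift_class // /evalsum big_seq1. Qed.

Lemma btensorW (P : btensor -> Prop) :
  (forall s, P (bclass s)) -> forall x, P x.
Proof. by move=> h x; rewrite -[x]bclass_repr. Qed.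

Definition badd (x y : btensor) : btensor :=
  bclass (repr (x : {eq_quot tensor_equiv}) ++ repr (y : {eq_quot tensor_equiv})).
Definition bopp (x : btensor) : btensor :=
  bclass [seq (- p.1, p.2) | p <- repr (x : {eq_quot tensor_equiv})].

Lemma balanced0l (Z : zmodType) (beta : M -> N -> Z) n :
  balanced beta -> beta 0 n = 0.
Proof. by case=> h _ _; apply: (addrI (beta 0 n)); rewrite -h !addr0. Qed.

Lemma balancedNl (Z : zmodType) (beta : M -> N -> Z) m n :
  balanced beta -> beta (- m) n = - beta m n.
Proof.
move=> hb; apply/eqP; rewrite -subr_eq0 opprK; case: (hb) => <- _ _.
by rewrite addNr balanced0l.
Qed.

Lemma evalsum_cat (Z : zmodType) (beta : M -> N -> Z) s t :
  evalsum beta (s ++ t) = evalsum beta s + evalsum beta t.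
Proof. by rewrite /evalsum big_cat. Qed.

Lemma evalsum_opp (Z : zmodType) (beta : M -> N -> Z) s : balanced beta ->
  evalsum beta [seq (- p.1, p.2) | p <- s] = - evalsum beta s.
Proof.
move=> hb; rewrite /evalsum big_map /= -sumrN.
by apply: eq_bigr => p _; rewrite balancedNl.
Qed.

Lemma evalsum_repr (Z : zmodType) (beta : M -> N -> Z) s : balanced beta ->
  evalsum beta (repr (bclass s : {eq_quot tensor_equiv})) = evalsum beta s.
Proof. exact: blift_class. Qed.

Lemma badd_class s t : badd (bclass s) (bclass t) = bclass (s ++ t).
Proof. by apply: bclass_eq => Z beta hb; rewrite !evalsum_cat !evalsum_repr. Qed.

Lemma bopp_class s : bopp (bclass s) = bclass [seq (- p.1, p.2) | p <- s].
Proof. by apply: bclass_eq => Z beta hb; rewrite !evalsum_opp ?evalsum_repr. Qed.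

Lemma baddA : associative badd.
Proof.
by elim/btensorW=> s; elim/btensorW=> t; elim/btensorW=> u;
  rewrite !badd_class catA.
Qed.

Lemma baddC : commutative badd.
Proof.
elim/btensorW=> s; elim/btensorW=> t; rewrite !badd_class.
by apply: bclass_eq => Z beta hb; rewrite !evalsum_cat addrC.
Qed.

Lemma badd0 : left_id (bclass [::]) badd.
Proof. by elim/btensorW=> s; rewrite badd_class. Qed.

Lemma baddN : left_inverse (bclass [::]) bopp badd.
Proof.
elim/btensorW=> s; rewrite bopp_class badd_class; apply: bclass_eq => Z beta hb.
by rewrite evalsum_cat evalsum_opp // addNr /evalsum big_nil.
Qed.

HB.instance Definition _ :=
  GRing.isZmodule.Build btensor baddA baddC badd0 baddN.

Lemma bclass_cat s t : bclass (s ++ t) = bclass s + bclass t.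
Proof. by rewrite -[RHS]/(badd _ _) badd_class. Qed.

Lemma bclassE s : bclass s = \sum_(p <- s) btens p.1 p.2.
Proof.
elim: s => [|p s IH]; first by rewrite big_nil.
by rewrite big_cons -IH -[LHS]/(bclass ([:: p] ++ s)) bclass_cat; case: p.
Qed.

Lemma bliftD (Z : zmodType) (beta : M -> N -> Z) x y :
  balanced beta -> blift beta (x + y) = blift beta x + blift beta y.
Proof.
move=> hb; move: x y; elim/btensorW=> s; elim/btensorW=> t.
by rewrite -bclass_cat !blift_class // evalsum_cat.
Qed.

Lemma btens_balanced : balanced btens.
Proof.
split=> *; rewrite /btens -?bclass_cat; apply: bclass_eq => Z beta [h1 h2 h3];
  by rewrite /evalsum !(big_cons, big_nil) /= ?addr0 ?h1 ?h2 ?h3.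
Qed.

End BalancedTensor.

Section VectorTensor.
Context {K : comPzRingType}.

Definition ctensor (V W : lmodType K) : Type :=
  btensor (fun (v : V) (k : K) => k *: v) (fun (k : K) (w : W) => k *: w).

HB.instance Definition _ (V W : lmodType K) := GRing.Zmodule.on (ctensor V W).

Definition tens (V W : lmodType K) (v : V) (w : W) : ctensor V W := btens _ _ v w.

(* blift is meaningful on biadditive maps balanced over K, which covers both  *)
(* bilinear maps and maps that are conjugate-linear in the two arguments.     *)
Definition tlift (V W : lmodType K) (Z : zmodType) (beta : V -> W -> Z)
  (x : ctensor V W) : Z := blift beta x.

Definition cbalanced (V W : lmodType K) (Z : zmodType) (beta : V -> W -> Z) :=
  balanced (fun (v : V) (k : K) => k *: v) (fun (k : K) (w : W) => k *: w) beta.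

Lemma tliftE (V W : lmodType K) (Z : zmodType) (beta : V -> W -> Z) v w :
  cbalanced beta -> tlift beta (tens v w) = beta v w.
Proof. exact: bliftE. Qed.

Lemma tliftD (V W : lmodType K) (Z : zmodType) (beta : V -> W -> Z) x y :
  cbalanced beta -> tlift beta (x + y) = tlift beta x + tlift beta y.
Proof. exact: bliftD. Qed.

Lemma tens_balanced (V W : lmodType K) : cbalanced (@tens V W).
Proof. exact: btens_balanced. Qed.

Lemma tensor_ind (V W : lmodType K) (P : ctensor V W -> Prop) :
  P 0 -> (forall v w, P (tens v w)) ->
  (forall x y, P x -> P y -> P (x + y)) -> forall x, P x.
Proof.
move=> h0 h1 h2; apply: btensorW => s; rewrite bclassE.
by elim/big_ind: _ => //; case=> v w _; apply: h1.
Qed.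

Definition tscale (V W : lmodType K) (k : K) (x : ctensor V W) : ctensor V W :=
  tlift (fun v w => tens (k *: v) w) x.

Lemma tscale_balanced (V W : lmodType K) (k : K) :
  cbalanced (fun (v : V) (w : W) => tens (k *: v) w).
Proof.
case: (tens_balanced V W) => h1 h2 h3; split=> *; rewrite ?scalerDr ?h1 ?h2 //.
by rewrite scalerA mulrC -scalerA h3.
Qed.

Lemma tscaleE (V W : lmodType K) k (v : V) (w : W) :
  tscale k (tens v w) = tens (k *: v) w.
Proof. by rewrite /tscale tliftE //; apply: tscale_balanced. Qed.

Lemma tscaleDr (V W : lmodType K) k : {morph @tscale V W k : x y / x + y}.
Proof. by move=> x y; rewrite /tscale tliftD //; apply: tscale_balanced. Qed.

Lemma tscale0 (V W : lmodType K) k : @tscale V W k 0 = 0.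
Proof. by apply: (addrI (@tscale V W k 0)); rewrite -tscaleDr !addr0. Qed.

Lemma tscaleA (V W : lmodType K) a b (x : ctensor V W) :
  tscale a (tscale b x) = tscale (a * b) x.
Proof.
elim/tensor_ind: x => [|v w|x y hx hy]; rewrite ?tscale0 //.
  by rewrite !tscaleE scalerA.
by rewrite !tscaleDr hx hy.
Qed.

Lemma tscale1 (V W : lmodType K) : left_id 1 (@tscale V W).
Proof.
elim/tensor_ind => [|v w|x y hx hy]; rewrite ?tscale0 //.
  by rewrite tscaleE scale1r.
by rewrite tscaleDr hx hy.
Qed.

Lemma tscaleDl (V W : lmodType K) (x : ctensor V W) :
  {morph (@tscale V W)^~ x : a b / a + b}.
Proof.
move=> a b; elim/tensor_ind: x => [|v w|x y hx hy]; rewrite ?tscale0 ?addr0 //.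
  by rewrite !tscaleE scalerDl; case: (tens_balanced V W) => ->.
by rewrite !tscaleDr hx hy addrACA.
Qed.

HB.instance Definition _ (V W : lmodType K) :=
  GRing.Zmodule_isLmodule.Build K (ctensor V W)
    (@tscaleA V W) (@tscale1 V W) (@tscaleDr V W) (@tscaleDl V W).

Definition tmap (V W V' W' : lmodType K) (f : V -> V') (g : W -> W')
  (x : ctensor V W) : ctensor V' W' := tlift (fun v w => tens (f v) (g w)) x.

Definition tmul (A D : algType K) (x y : ctensor A D) : ctensor A D :=
  tlift (fun a c => tlift (fun b e => tens (a * b) (c * e)) y) x.

(* The image of V ⊗ Q in V ⊗ W, for a subspace Q of W. *)
Definition tens_in (V W : lmodType K) (Q : set W) : set (ctensor V W) :=
  [set x | exists2 s : seq (V * W), (forall p, p \in s -> Q p.2)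
                                  & x = \sum_(p <- s) tens p.1 p.2].

End VectorTensor.

Notation "V ⊗ W" := (ctensor V W) : type_scope.
Notation "v ⊗ w" := (tens v w) : ring_scope.

Section Modules.
Context {B : nzRingType}.

Definition exact_at (X Y Z : zmodType) (f : X -> Y) (g : Y -> Z) : Prop :=
  forall y, g y = 0 <-> exists x, f x = y.

Definition btensor_map (A : zmodType) (ra : A -> B -> A) (N N' : lmodType B)
    (f : N -> N') :
    btensor ra (fun b (m : N) => b *: m) -> btensor ra (fun b (m : N') => b *: m) :=
  blift (fun a m => btens ra (fun b (m : N') => b *: m) a (f m)).

Arguments btensor_map {A} ra {N N'} f _.

Definition faithfully_flat (A : zmodType) (ra : A -> B -> A) : Prop :=
  forall (N1 N2 N3 : lmodType B) (f : {linear N1 -> N2}) (g : {linear N2 -> N3}),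
    exact_at f g <-> exact_at (btensor_map ra f) (btensor_map ra g).

Definition fin_gen (F : zmodType) (act : B -> F -> F) : Prop :=
  exists (r : nat) (e : 'I_r -> F),
    forall f, exists c : 'I_r -> B, f = \sum_(i < r) act (c i) (e i).

Definition projective (F : lmodType B) : Prop :=
  forall (M N : lmodType B) (p : {linear M -> N}) (u : {linear F -> N}),
    (forall y, exists x, p x = y) ->
    exists v : {linear F -> M}, forall f, p (v f) = u f.

(* The underlying set of Hom_B(F, B). *)
Definition dual (F : lmodType B) : set (F -> B) :=
  [set phi | linear (phi : F -> B^o)].

End Modules.

Section StarAlgebra.
Context {R : realType}.
Local Notation C := R[i].

Record conj_involution (V : lmodType C) (star : V -> V) : Prop := {
  conj_inv_lin : forall (c : C) u v, star (c *: u + v) = c^* *: star u + star v;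
  conj_inv_invol : involutive star }.

Record star_algebra (A : algType C) (star : A -> A) : Prop := {
  star_conj_inv : conj_involution star;
  star_mul : forall a b, star (a * b) = star b * star a }.

(* B_{>0} *)
Definition pos_cone (B : algType C) (star : B -> B) : set B :=
  [set b | b != 0 /\ exists2 s : seq (R * B), (forall p, p \in s -> 0 < p.1)
                     & b = \sum_(p <- s) (p.1)%:C *: (star p.2 * p.2)].

(* h k f stands for h(f, k) = h(conj k)(f).  The conjugate module of F has    *)
(* the elements of F with conj(k) b = conj(star b *: k), and (phi b)(f) is    *)
(* phi(f) b on the dual; hm_additive, hm_right and hm_bij thus say that       *)
(* h is an isomorphism of right B-modules from conj(F) to Hom_B(F, B).        *)
Record hermitian_module (B : algType C) (star : B -> B) (F : lmodType B)
    (h : F -> F -> B) : Prop := {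
  hm_fin_gen : fin_gen (fun (b : B) (f : F) => b *: f);
  hm_projective : projective F;
  hm_bij : set_bij [set: F] (@dual B F) h;
  hm_additive : forall k k' f, h (k + k') f = h k f + h k' f;
  hm_right : forall k b f, h (star b *: k) f = h k f * b;
  hm_sym : forall f k, h k f = star (h f k);
  hm_pos : forall f, f != 0 -> pos_cone star (h f f) }.

End StarAlgebra.

Section HopfStarAlgebra.
Context {R : realType}.
Local Notation C := R[i].
Context {A : algType C} (Delta : A -> A ⊗ A) (eps : A -> C) (S star : A -> A).

Record hopf_algebra : Prop := {
  Delta_linear : linear Delta;
  Delta_one : Delta 1 = 1 ⊗ 1;
  Delta_mul : forall a b, Delta (a * b) = tmul (Delta a) (Delta b);
  eps_linear : linear (eps : A -> C^o);
  eps_one : eps 1 = 1;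
  eps_mul : forall a b, eps (a * b) = eps a * eps b;
  coassoc : forall a,
    tlift (fun x y => tlift (fun x1 x2 => x1 ⊗ (x2 ⊗ y)) (Delta x)) (Delta a)
    = tlift (fun x y => x ⊗ Delta y) (Delta a);
  counit_l : forall a, tlift (fun x y => eps x *: y) (Delta a) = a;
  counit_r : forall a, tlift (fun x y => eps y *: x) (Delta a) = a;
  S_linear : linear S;
  antipode_l : forall a, tlift (fun x y => S x * y) (Delta a) = eps a *: 1;
  antipode_r : forall a, tlift (fun x y => x * S y) (Delta a) = eps a *: 1 }.

Record hopf_star_algebra : Prop := {
  hsa_hopf : hopf_algebra;
  hsa_star : star_algebra star;
  Delta_star : forall a, Delta (star a) = tmap star star (Delta a);
  eps_star : forall a, eps (star a) = (eps a)^* }.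

Record left_comodule (F : lmodType C) (rho : F -> A ⊗ F) : Prop := {
  rho_linear : linear rho;
  rho_coassoc : forall f,
    tlift (fun x f0 => tlift (fun x1 x2 => x1 ⊗ (x2 ⊗ f0)) (Delta x)) (rho f)
    = tlift (fun x f0 => x ⊗ rho f0) (rho f);
  rho_counit : forall f, tlift (fun x f0 => eps x *: f0) (rho f) = f }.

Context {P : {pred A}} {B : subAlgType P}.

(* B is a subalgebra of A through val; DeltaB is Delta restricted to B with   *)
(* values in A ⊗ B, which is unique since A ⊗ B -> A ⊗ A is injective.        *)
Definition left_coideal (DeltaB : B -> A ⊗ B) : Prop :=
  forall b, tmap id (val : B -> A) (DeltaB b) = Delta (val b).

Definition augmentation : set A :=
  [set a | exists2 b : B, eps (val b) = 0 & a = val b].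

Definition span_mul (X Y : set A) : set A :=
  [set a | exists2 s : seq (A * A), (forall p, p \in s -> X p.1 /\ Y p.2)
                                  & a = \sum_(p <- s) p.1 * p.2].

Record quantum_homogeneous_space (DeltaB : B -> A ⊗ B) : Prop := {
  qhs_coideal : left_coideal DeltaB;
  qhs_flat : faithfully_flat (fun (a : A) (b : B) => a * val b);
  qhs_aug : span_mul augmentation [set: A] = span_mul [set: A] augmentation }.

Context (DeltaB : B -> A ⊗ B).

Record relative_hopf_module (F : lmodType C) (act : B -> F -> F)
    (rho : F -> A ⊗ F) : Prop := {
  rhm_comodule : left_comodule rho;
  act_linear_l : forall f, linear (act^~ f);
  act_linear_r : forall b, linear (act b);
  act_one : forall f, act 1 f = f;
  act_mul : forall b b' f, act (b * b') f = act b (act b' f);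
  rhm_fin_gen : fin_gen act;
  rhm_compat : forall b f,
    rho (act b f) =
    tlift (fun a b0 => tlift (fun a' f0 => (a * a') ⊗ act b0 f0) (rho f))
          (DeltaB b) }.

(* f b = f_(-2) b S(f_(-1)) f_(0).  The tensor f_(-2) b S(f_(-1)) ⊗ f_(0)     *)
(* a priori lies in A ⊗ F; it comes from a (unique) t in B ⊗ F, and the       *)
(* formula applies the left action of B to t.                                 *)
Record mod0_object (F : lmodType C) (act : B -> F -> F) (ract : F -> B -> F)
    (rho : F -> A ⊗ F) : Prop := {
  mod0_rhm : relative_hopf_module act rho;
  mod0_ract : forall f b, exists2 t : B ⊗ F,
    tmap (val : B -> A) id t =
      tlift (fun a f0 =>
        tlift (fun a1 a2 => (a1 * val b * S a2) ⊗ f0) (Delta a)) (rho f)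
    & ract f b = tlift act t }.

End HopfStarAlgebra.

Section Gradings.
Context {K : nzRingType}.

Definition is_subspace (V : lmodType K) (Q : set V) : Prop :=
  Q 0 /\ forall (c : K) u v, Q u -> Q v -> Q (c *: u + v).

Definition decomposes (V : lmodType K) (I : choiceType) (deg : I -> set V)
    (v : V) (f : I -> V) : Prop :=
  [/\ forall i, deg i (f i), finite_set [set i | f i != 0]
    & v = \sum_(i \in [set: I]) f i].

Definition direct_sum (V : lmodType K) (I : choiceType) (deg : I -> set V) :=
  (forall i, is_subspace (deg i)) /\ forall v, exists! f, decomposes deg v f.

Definition component (V : lmodType K) (I : choiceType) (deg : I -> set V)
    (i : I) (v : V) : V :=
  xget 0 [set x | exists2 f, decomposes deg v f & x = f i].

Definition subalgebra (Om : lalgType K) (Q : set Om) : Prop :=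
  [/\ is_subspace Q, Q 1 & forall u v, Q u -> Q v -> Q (u * v)].

End Gradings.

(* Om as a left module over B through j : B -> Om. *)
Definition restr_mod (B Om : nzRingType) (j : {rmorphism B -> Om}) : Type := Om.

Section RestrMod.
Context (B Om : nzRingType) (j : {rmorphism B -> Om}).

HB.instance Definition _ := GRing.Zmodule.on (restr_mod j).

Definition restr_scale (b : B) (w : restr_mod j) : restr_mod j := j b * (w : Om).

Lemma restr_scaleA a b (w : restr_mod j) :
  restr_scale a (restr_scale b w) = restr_scale (a * b) w.
Proof. by rewrite /restr_scale rmorphM mulrA. Qed.

Lemma restr_scale1 : left_id 1 restr_scale.
Proof. by move=> w; rewrite /restr_scale rmorph1 mul1r. Qed.

Lemma restr_scaleDr : right_distributive restr_scale +%R.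
Proof. by move=> b u v; rewrite /restr_scale mulrDr. Qed.

Lemma restr_scaleDl (w : restr_mod j) : {morph restr_scale^~ w : a b / a + b}.
Proof. by move=> a b; rewrite /restr_scale rmorphD mulrDl. Qed.

HB.instance Definition _ := GRing.Zmodule_isLmodule.Build B (restr_mod j)
  restr_scaleA restr_scale1 restr_scaleDr restr_scaleDl.

End RestrMod.

Section Calculi.
Context {R : realType}.
Local Notation C := R[i].
Context {A : algType C} (Delta : A -> A ⊗ A) (eps : A -> C).
Context {P : {pred A}} {B : subAlgType P} (DeltaB : B -> A ⊗ B).
Context (starB : B -> B).
(* Om is the total algebra of the calculus, deg k its degree k part, and j    *)
(* the identification of B with deg 0.                                        *)
Context {Om : algType C} (deg : nat -> set Om) (j : {lrmorphism B -> Om}).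
Context (d star : Om -> Om) (rho : Om -> A ⊗ Om).

Record differential_calculus : Prop := {
  dc_grading : direct_sum deg;
  dc_one : deg 0%N 1;
  dc_mul : forall k l w v, deg k w -> deg l v -> deg (k + l)%N (w * v);
  dc_j_inj : injective j;
  dc_deg0 : deg 0%N = range j;
  dc_linear : linear d;
  dc_deg : forall k w, deg k w -> deg k.+1 (d w);
  dc_dd : forall w, d (d w) = 0;
  dc_leibniz : forall k w v, deg k w ->
    d (w * v) = d w * v + (-1) ^+ k *: (w * d v);
  dc_gen : forall Q : set Om, subalgebra Q ->
    (forall b, Q (j b)) -> (forall b, Q (d (j b))) -> Q = [set: Om] }.

Definition total_degree (m : nat) : Prop :=
  (exists2 w, deg m w & w != 0) /\
  (forall k w, (m < k)%N -> deg k w -> w = 0).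

Record star_calculus : Prop := {
  sc_conj_inv : conj_involution star;
  sc_ext : forall b, star (j b) = j (starB b);
  sc_d : forall w, d (star w) = star (d w);
  sc_mul : forall k l w v, deg k w -> deg l v ->
    star (w * v) = (-1) ^+ (k * l)%N *: (star v * star w) }.

Record covariant_calculus : Prop := {
  cc_comodule : left_comodule Delta eps rho;
  cc_one : rho 1 = 1 ⊗ 1;
  cc_mul : forall w v, rho (w * v) = tmul (rho w) (rho v);
  cc_ext : forall b, rho (j b) = tmap id j (DeltaB b);
  cc_d : forall w, rho (d w) = tmap id d (rho w) }.

Context (bideg : nat -> nat -> set Om).

Record complex_structure : Prop := {
  cs_grading : direct_sum (fun ab : nat * nat => bideg ab.1 ab.2);
  cs_one : bideg 0%N 0%N 1;
  cs_mul : forall a b a' b' w v, bideg a b w -> bideg a' b' v ->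
    bideg (a + a')%N (b + b')%N (w * v);
  cs_sum : forall k, deg k = [set w | exists2 f : nat -> Om,
    (forall a, (a <= k)%N -> bideg a (k - a)%N (f a))
    & w = \sum_(a < k.+1) f a];
  cs_star : forall a b, star @` bideg a b = bideg b a;
  cs_d : exists del delbar : {linear Om -> Om},
    [/\ forall w, d w = del w + delbar w,
        forall a b w, bideg a b w -> bideg a.+1 b (del w)
      & forall a b w, bideg a b w -> bideg a b.+1 (delbar w)] }.

Definition covariant_complex_structure : Prop :=
  forall a b w, bideg a b w -> tens_in (bideg a b) (rho w).

Context (n : nat) (sigma : Om).

Definition lefschetz (w : Om) : Om := sigma * w.

Record hermitian_structure : Prop := {
  hs_complex : complex_structure;
  hs_central : forall w, sigma * w = w * sigma;
  hs_real : star sigma = sigma;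
  hs_bideg : bideg 1%N 1%N sigma;
  hs_lefschetz : forall k, (k < n)%N ->
    set_bij (deg k) (deg (2 * n - k)%N) (iter (n - k) lefschetz) }.

Record covariant_hermitian_structure : Prop := {
  chs_complex : covariant_complex_structure;
  chs_sigma : rho sigma = 1 ⊗ sigma }.

Definition primitive (a b : nat) : set Om :=
  [set w | [/\ (a + b <= n)%N, bideg a b w
             & iter (n - (a + b)).+1 lefschetz w = 0]].

Definition hodge_coef (a b l : nat) : C :=
  let k := (a + b)%N in
  (-1) ^+ ((k * k.+1) %/ 2)%N * 'i ^ (a%:Z - b%:Z)
  * (l`!%:R / ((n - l - k)`!)%:R).

Definition is_hodge (H : Om -> Om) : Prop :=
  linear H /\
  forall a b l w, primitive a b w -> (l <= n - (a + b))%N ->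
    H (iter l lefschetz w)
    = hodge_coef a b l *: iter (n - l - (a + b)) lefschetz w.

(* For an Hermitian structure there is exactly one H satisfying is_hodge. *)
Definition hodge (w : Om) : Om :=
  xget 0 [set v | exists2 H, is_hodge H & v = H w].

(* metric w v is g_sigma(w, v), extended to inhomogeneous forms so that       *)
(* distinct degrees are orthogonal; the sum lies in degree 0, and is          *)
(* transported to B by the inverse of j.                                      *)
Definition metric (w v : Om) : B :=
  xget 0 [set b | j b = \sum_(k < (2 * n).+1)
    hodge (component deg k w * hodge (star (component deg k v)))].

Definition positive_definite : Prop :=
  forall w, w != 0 -> pos_cone starB (metric w w).

(* conj(w) |-> g_sigma(-, w) *)
Definition h_sigma (w : restr_mod j) : restr_mod j -> B :=
  fun v => metric v w.

End Calculi.

(* Main.v *)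
Require Import Defs.
From HB Require Import structures.
From mathcomp Require Import all_boot all_order all_algebra.
From mathcomp Require Import complex zify.
From mathcomp Require Import mathcomp_extra boolp classical_sets functions.
From mathcomp Require Import cardinality fsbigop reals.

Set Implicit Arguments.
Unset Strict Implicit.
Unset Printing Implicit Defensive.

Import Order.TTheory GRing.Theory Num.Theory.

Local Open Scope ring_scope.
Local Open Scope complex_scope.

(** Write tau(f, z) for the element of B given by the degreewise sum of the
    forms H(f /\ H(z)), with H the Hodge map; then g(w, v) = tau(w, star v),
    so the claim is about tau.

    The Hodge map exists because the bijectivity of the powers of
    L = sigma /\ - yields the Lefschetz decomposition: every form is a sum of
    forms L^l alpha with alpha primitive ([lefschetz_ind]).  As sigma is
    central, real and coinvariant, H is a B-bimodule map, commutes with star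
    and is a comodule map.  For forms f, z of the same degree k one has
    f /\ H(z) = (-1)^k H(f) /\ z ([hodge_wedge]): in the product of L^i alpha
    and L^m beta only i = m survives, and since forms of top degree have
    bidegree (n, n), the bidegrees of alpha and beta are then exchanged.  This
    is what makes the metric Hermitian.  So tau is B-linear on both sides,
    balanced in the middle, Hermitian, and covariant, that is
      tau(f, z) = f_(-1) z_(-1) eps(tau(f_0, z_0)).

    Projectivity of the module and surjectivity of the map into its dual both
    follow from one statement ([tau_frame]): there are finitely many x_i, y_i
    with z = sum_i y_i tau(x_i, z) for all z.  Applying star gives
    f = sum_i g(f, x_i) (star y_i), which is a dual basis consisting of
    functionals g(-, x_i).

    To find such a frame, pass to the balanced tensor product of A with the
    module of forms.  There z |-> s(z) = S(z_(-1)) (x) z_0 is a section of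
    coinvariants with 1 (x) z = z_(-1) s(z_0), and the bimodule condition of
    the category gives s(z) b = b s(z) ([coinv_rmul]).  The scalar form
    beta = eps tau has as its radical exactly the kernel of s: flatness of A
    over B, applied to the injection of the forms into a free module by
    finitely many functionals tau(-, z_l), shows that s kills the left
    radical ([coinv_null]); the converse holds for the right radical
    ([coinv_null_beta]); and the two radicals are exchanged by star.  Modulo
    this radical the module is finite-dimensional, so linear algebra provides
    e_k, v_k with s(z) = sum_k beta(e_k, z) s(v_k), and covariance turns this
    into 1 (x) z = sum_k S(e_k_(-1)) s(v_k) tau(e_k_0, z) ([coinv_frame]).
    This is a solution, over A, of finitely many B-linear equations with
    coefficients tau(x_i, z); faithful flatness descends it to the module of
    forms itself ([ff_descent]). *)

(** * Faithfully flat descent of linear equations *)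
Local Notation bmap ra f := (@btensor_map _ _ ra _ _ f).

Section BalancedMaps.
Context {B : nzRingType} {A : zmodType} (ra : A -> B -> A).

Lemma btensor_ind (N : lmodType B)
    (Q : btensor ra (fun b (m : N) => b *: m) -> Prop) :
  (forall a m, Q (btens _ _ a m)) -> (forall x y, Q x -> Q y -> Q (x + y)) ->
  Q 0 -> forall x, Q x.
Proof.
move=> h1 h2 h0; apply: btensorW => s; rewrite bclassE.
by elim/big_ind: _.
Qed.

Section Map.
Context {N N' : lmodType B} (f : {linear N -> N'}).

Lemma btensor_map_balanced :
  balanced ra (fun b (m : N) => b *: m)
    (fun a m => btens ra (fun b (m : N') => b *: m) a (f m)).
Proof.
case: (btens_balanced ra (fun b (m : N') => b *: m)) => h1 h2 h3.
by split=> *; rewrite ?linearD ?linearZ ?h1 ?h2 ?h3.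
Qed.

Lemma btensor_mapE a m :
  bmap ra f (btens _ _ a m) = btens ra (fun b (m : N') => b *: m) a (f m).
Proof. by rewrite /btensor_map bliftE //; apply: btensor_map_balanced. Qed.

Lemma btensor_mapD : {morph bmap ra f : x y / x + y}.
Proof. by move=> x y; rewrite /btensor_map bliftD //; apply: btensor_map_balanced. Qed.

Lemma btensor_map0 : bmap ra f 0 = 0.
Proof. by apply: (addrI (bmap ra f 0)); rewrite -btensor_mapD !addr0. Qed.

End Map.

Lemma btens0r (N : lmodType B) a : btens ra (fun b (m : N) => b *: m) a 0 = 0.
Proof.
case: (btens_balanced ra (fun b (m : N) => b *: m)) => _ h2 _.
by apply: (addrI (btens _ _ a 0)); rewrite -h2 !addr0.
Qed.

Lemma btensor_map_comp (N N' N'' : lmodType B) (f : {linear N -> N'})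
    (g : {linear N' -> N''}) (h : {linear N -> N''}) :
  (forall m, h m = g (f m)) ->
  forall x, bmap ra h x = bmap ra g (bmap ra f x).
Proof.
move=> e; elim/btensor_ind => [a m|x y hx hy|].
- by rewrite !btensor_mapE e.
- by rewrite !btensor_mapD hx hy.
- by rewrite !btensor_map0.
Qed.

Lemma btensor_map_null (N N' : lmodType B) (f : {linear N -> N'}) :
  (forall m, f m = 0) -> forall x, bmap ra f x = 0.
Proof.
move=> e; elim/btensor_ind => [a m|x y hx hy|].
- by rewrite btensor_mapE e btens0r.
- by rewrite btensor_mapD hx hy addr0.
- by rewrite btensor_map0.
Qed.

End BalancedMaps.

(** Submodules are bundled with their closure property so that the subtype can
    carry a module structure found by unification. *)
Record submodule (B : nzRingType) (V : lmodType B) := Submodule {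
  sm_pred :> {pred V};
  sm_closed : submod_closed sm_pred }.

HB.instance Definition _ (B : nzRingType) (V : lmodType B) (D : submodule V) :=
  GRing.isSubmodClosed.Build B V (sm_pred D) (sm_closed D).

Record submod (B : nzRingType) (V : lmodType B) (D : submodule V) := Submod {
  submod_val : V;
  submod_mem : submod_val \in sm_pred D }.

HB.instance Definition _ (B : nzRingType) (V : lmodType B) (D : submodule V) :=
  [isSub of submod D for @submod_val B V D].
HB.instance Definition _ (B : nzRingType) (V : lmodType B) (D : submodule V) :=
  [Choice of submod D by <:].
HB.instance Definition _ (B : nzRingType) (V : lmodType B) (D : submodule V) :=
  [SubChoice_isSubLmodule of submod D by <:].

Section Flatness.
Context {B : nzRingType} {A : zmodType} (ra : A -> B -> A).
Hypothesis ffA : faithfully_flat ra.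

Lemma flat_inj (M N : lmodType B) (f : {linear M -> N}) :
  injective f ->
  forall x : btensor ra (fun b (m : M) => b *: m),
    bmap ra f x = 0 -> x = 0.
Proof.
move=> fI x hx.
have [h _] := ffA (\0 : {linear 'rV[B]_0 -> M}) f.
have /h/(_ x) [/(_ hx)[y <-] _] : exact_at (\0 : {linear 'rV[B]_0 -> M}) f.
  move=> y; split=> [h0|[m <-]]; last by rewrite linear0.
  by exists 0; apply: fI; rewrite h0 /= linear0.
exact: btensor_map_null.
Qed.

Lemma ff_surj (M N : lmodType B) (f : {linear M -> N}) :
  (forall y, exists x, bmap ra f x = y) ->
  forall y, exists x, f x = y.
Proof.
move=> fS y.
have [_ h] := ffA f (\0 : {linear N -> 'rV[B]_0}).
have /h/(_ y) [/(_ erefl) //] :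
  exact_at (bmap ra f) (bmap ra (\0 : {linear N -> 'rV[B]_0})).
by move=> t; split=> _; [apply: fS | apply: btensor_map_null].
Qed.

Section Descent.
Context {X Y : lmodType B} (u : {linear X -> Y}) (y : Y).

Definition extended_image : {pred Y} :=
  fun v => `[< exists x b, v = u x + b *: y >].

Lemma extended_image_closed : submod_closed extended_image.
Proof.
split=> [|c v w /asboolP[x [b ->]] /asboolP[x' [b' ->]]]; apply/asboolP.
  by exists 0, 0; rewrite linear0 scale0r addr0.
exists (c *: x + x'), (c * b + b').
by rewrite linearP scalerDl scalerDr scalerA addrACA.
Qed.

Definition extended_submodule := Submodule extended_image_closed.

Lemma image_extended x : u x \in extended_submodule.
Proof. by apply/asboolP; exists x, 0; rewrite scale0r addr0. Qed.

Definition extended_corestr x : submod extended_submodule :=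
  Submod (image_extended x).

Lemma extended_corestr_linear : linear extended_corestr.
Proof. by move=> c v w; apply: val_inj; rewrite linearP /= linearP. Qed.

HB.instance Definition _ :=
  GRing.isLinear.Build B X (submod extended_submodule) _ extended_corestr
    extended_corestr_linear.

(** Both halves of faithful flatness are used, on the submodule N generated by
    the image of u and by y: N embeds in Y after tensoring, so the hypothesis
    makes the corestriction of u to N surjective after tensoring, hence
    surjective. *)
Lemma ff_descent :
  (forall a, exists w, bmap ra u w = btens _ _ a y) ->
  exists x, u x = y.
Proof.
move=> hy.
pose i : {linear submod extended_submodule -> Y} := val.
have iE w : bmap ra i (bmap ra extended_corestr w)
    = bmap ra u w.
  by apply/esym/btensor_map_comp.
have onto t : exists w, bmap ra extended_corestr w = t.
  move: t; apply: (@btensor_ind B) => [a m|t t' [w <-] [w' <-]|]; last first.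
  - by exists 0; rewrite btensor_map0.
  - by exists (w + w'); rewrite btensor_mapD.
  have /asboolP[x [b hm]] := submod_mem m.
  (* The tensor of a and u x + b y comes from that of a and x together with a
     preimage of the tensor of a b and y. *)
  have [w hw] := hy (ra a b).
  exists (btens _ _ a x + w); apply/eqP; rewrite -subr_eq0; apply/eqP.
  have iN t : bmap ra i (- t) = - bmap ra i t.
    by apply/eqP; rewrite -subr_eq0 opprK -btensor_mapD addNr btensor_map0.
  apply: (@flat_inj _ _ i) => [|]; first exact: val_inj.
  rewrite btensor_mapD iN iE btensor_mapD hw !btensor_mapE.
  case: (btens_balanced ra (fun b (m : Y) => b *: m)) => _ h2 h3.
  by rewrite h3 -h2 /i /= -hm subrr.
have my : y \in extended_submodule.
  by apply/asboolP; exists 0, 1; rewrite linear0 scale1r add0r.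
have [x hx] := ff_surj onto (Submod my).
by exists x; have := congr1 val hx.
Qed.

End Descent.
End Flatness.
(** * Sums over tensors and comodules *)
Section LinearMaps.
Context {K : pzRingType} {V W : lmodType K} {f : V -> W}.
Hypothesis hf : linear f.

Lemma linear_add : {morph f : a b / a + b}.
Proof. by move=> a b; rewrite -[a]scale1r hf !scale1r. Qed.

Lemma linear_zero : f 0 = 0.
Proof. by apply: (addrI (f 0)); rewrite -linear_add !addr0. Qed.

Lemma linear_scale k a : f (k *: a) = k *: f a.
Proof. by rewrite -[k *: a]addr0 hf linear_zero addr0. Qed.

Lemma linear_opp a : f (- a) = - f a.
Proof. by rewrite -!scaleN1r linear_scale. Qed.

Lemma linear_bigsum (I : Type) (s : seq I) (Q : pred I) (g : I -> V) :
  f (\sum_(i <- s | Q i) g i) = \sum_(i <- s | Q i) f (g i).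
Proof. exact: (big_morph f linear_add linear_zero). Qed.

End LinearMaps.

Section TensorSums.
Context {K : comPzRingType}.
Implicit Types V W : lmodType K.

(** [tlift] is a finite sum over a chosen representative of the tensor, so the
    rules for sums of functions hold for arbitrary maps; balancedness matters
    only where the tensor itself changes. *)
Lemma eq_tlift V W (Z : zmodType) (beta gamma : V -> W -> Z) x :
  (forall v w, beta v w = gamma v w) -> tlift beta x = tlift gamma x.
Proof. by move=> e; apply: eq_bigr. Qed.

Lemma tlift_morph V W (Z Z' : zmodType) (h : Z -> Z') (beta : V -> W -> Z) x :
  {morph h : a b / a + b} -> h (tlift beta x) = tlift (fun v w => h (beta v w)) x.
Proof.
move=> hD; have h0 : h 0 = 0 by apply: (addrI (h 0)); rewrite -hD !addr0.
exact: (big_morph h hD h0).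
Qed.

Lemma tlift_addf V W (Z : zmodType) (beta gamma : V -> W -> Z) x :
  tlift (fun v w => beta v w + gamma v w) x = tlift beta x + tlift gamma x.
Proof. exact: big_split. Qed.

Lemma tlift_sumf V W (Z : zmodType) (I : Type) (s : seq I) (Q : pred I)
    (beta : I -> V -> W -> Z) x :
  tlift (fun v w => \sum_(i <- s | Q i) beta i v w) x
  = \sum_(i <- s | Q i) tlift (beta i) x.
Proof. exact: exchange_big. Qed.

Lemma tlift_0f V W (Z : zmodType) (x : V ⊗ W) : tlift (fun _ _ => 0 : Z) x = 0.
Proof. by apply: big1. Qed.

Lemma tlift0 V W (Z : zmodType) (beta : V -> W -> Z) :
  cbalanced beta -> tlift beta 0 = 0.
Proof. by move=> hb; apply: (addrI (tlift beta 0)); rewrite -tliftD // !addr0. Qed.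

Lemma tliftZ V W (Z : zmodType) (beta : V -> W -> Z) k x : cbalanced beta ->
  tlift beta (k *: x) = tlift (fun v w => beta (k *: v) w) x.
Proof.
move=> hb; rewrite -[k *: x]/(tscale k x) /tscale tlift_morph; last first.
  by move=> a b; apply: tliftD.
by apply: eq_tlift => v w; rewrite tliftE.
Qed.

Lemma tlift_sum V W (Z : zmodType) (beta : V -> W -> Z) (s : seq (V * W)) :
  cbalanced beta ->
  tlift beta (\sum_(p <- s) p.1 ⊗ p.2) = \sum_(p <- s) beta p.1 p.2.
Proof.
move=> hb; rewrite (big_morph _ (fun a b => tliftD a b hb) (tlift0 hb)).
by apply: eq_bigr => p _; rewrite tliftE.
Qed.

Lemma tensor_sum V W (x : V ⊗ W) :
  exists s : seq (V * W), x = \sum_(p <- s) p.1 ⊗ p.2.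
Proof. by move: x; apply: btensorW => s; exists s; rewrite bclassE. Qed.

Lemma tlift_comp V W V' W' (Z : zmodType) (beta : V -> W -> Z)
    (g : V' -> W' -> V ⊗ W) x : cbalanced beta ->
  tlift beta (tlift g x) = tlift (fun v w => tlift beta (g v w)) x.
Proof. by move=> hb; apply: tlift_morph => a b; apply: tliftD. Qed.

Lemma bilinear_balanced V W (Z : lmodType K) (beta : V -> W -> Z) :
  (forall w, linear (beta^~ w)) -> (forall v, linear (beta v)) ->
  cbalanced beta.
Proof.
move=> hl hr.
split=> [v v' w|v w w'|v k w]; first exact: (linear_add (hl w)).
  exact: (linear_add (hr v)).
by rewrite (linear_scale (hl w)) (linear_scale (hr v)).
Qed.

(** The maps out of a triple tensor product, bracketed to the right; only
    additivity and the passing of scalars between arguments is asked for, as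
    the values may lie in a group without scalar action. *)
Definition trilinear (V1 V2 V3 : lmodType K) (Z : zmodType)
    (theta : V1 -> V2 -> V3 -> Z) : Prop :=
  [/\ forall x, cbalanced (theta x),
      forall x x' y z, theta (x + x') y z = theta x y z + theta x' y z
    & forall k x y z, theta (k *: x) y z = theta x (k *: y) z].

Lemma trilinear_tlift (V1 V2 V3 W : lmodType K) (Z : zmodType)
    (theta : V1 -> V2 -> V3 -> Z) (g : W -> V2 ⊗ V3) :
  trilinear theta -> linear g -> cbalanced (fun v w => tlift (theta v) (g w)).
Proof.
move=> [h1 h2 h3] hg; split=> [v v' w|v w w'|v k w].
- by rewrite -tlift_addf; apply: eq_tlift.
- by rewrite (linear_add hg) tliftD.
- by rewrite (linear_scale hg) tliftZ //; apply: eq_tlift.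
Qed.

End TensorSums.

Section Comodules.
Context {R : realType}.
Local Notation C := R[i].
Context {A : algType C} {Delta : A -> A ⊗ A} {eps : A -> C} {S : A -> A}.
Context {F : lmodType C} {rho : F -> A ⊗ F}.
Hypothesis hrho : left_comodule Delta eps rho.

(** Sweedler notation f_(-2), f_(-1), f_0 made unambiguous: a trilinear
    expression may be evaluated with either bracketing. *)
Lemma comodule_coassoc (Z : zmodType) (theta : A -> A -> F -> Z) f :
  trilinear theta ->
  tlift (fun a f0 => tlift (fun x y => theta x y f0) (Delta a)) (rho f)
  = tlift (fun a f0 => tlift (theta a) (rho f0)) (rho f).
Proof.
move=> ht; case: (ht) => h1 h2 h3.
pose G : (A ⊗ (A ⊗ F))%type -> Z := tlift (fun a t => tlift (theta a) t).
have hb : cbalanced (fun a (t : A ⊗ F) => tlift (theta a) t).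
  by apply: (trilinear_tlift (g := id)).
have GD : {morph G : a b / a + b} by move=> a b; apply: tliftD.
have := congr1 G (rho_coassoc hrho f).
rewrite !(tlift_morph _ _ GD) => h.
have -> : tlift (fun a f0 => tlift (theta a) (rho f0)) (rho f)
    = tlift (fun a f0 => G (a ⊗ rho f0)) (rho f).
  by apply: eq_tlift => a f0; rewrite /G tliftE.
rewrite -h; apply: eq_tlift => a f0; rewrite (tlift_morph _ _ GD).
by apply: eq_tlift => x y; rewrite /G tliftE // tliftE.
Qed.

Lemma comodule_counit (Z : zmodType) (h : F -> Z) f :
  {morph h : a b / a + b} -> tlift (fun a f0 => h (eps a *: f0)) (rho f) = h f.
Proof. by move=> hD; rewrite -(tlift_morph _ _ hD) (rho_counit hrho). Qed.

Hypothesis hA : hopf_algebra Delta eps S.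

Lemma antipodeD : {morph S : a b / a + b}.
Proof. exact: linear_add (S_linear hA). Qed.

Lemma antipodeZ k a : S (k *: a) = k *: S a.
Proof. exact: linear_scale (S_linear hA) k a. Qed.

(** By coassociativity and the antipode axiom, S(f_(-2)) f_(-1) (x) f_0 =
    1 (x) f; an identity of tensors is used by evaluating balanced maps psi. *)
Lemma antipode_cancel_l (Z : zmodType) (psi : A -> F -> Z) f : cbalanced psi ->
  tlift (fun a f0 => tlift (fun a1 f1 => psi (S a * a1) f1) (rho f0)) (rho f)
  = psi 1 f.
Proof.
move=> hp; case: (hp) => p1 p2 p3.
rewrite -comodule_coassoc; last first.
  split=> [a|a a' b g|k a b g].
  - split=> [b b' g|b g g'|b k g]; first by rewrite mulrDr p1.
      by rewrite p2.
    by rewrite -p3 scalerAr.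
  - by rewrite antipodeD mulrDl p1.
  - by rewrite antipodeZ -scalerAl scalerAr.
transitivity (tlift (fun a f0 => psi 1 (eps a *: f0)) (rho f)).
  apply: eq_tlift => a f0.
  rewrite -(tlift_morph (h := psi^~ f0)); last by move=> b b'; apply: p1.
  by rewrite (antipode_l hA) p3.
by rewrite (comodule_counit (h := psi 1)).
Qed.

(** The same for f_(-2) S(f_(-1)) (x) f_0 = 1 (x) f. *)
Lemma antipode_cancel_r (Z : zmodType) (psi : A -> F -> Z) f : cbalanced psi ->
  tlift (fun a f0 => tlift (fun a1 f1 => psi (a * S a1) f1) (rho f0)) (rho f)
  = psi 1 f.
Proof.
move=> hp; case: (hp) => p1 p2 p3.
rewrite -comodule_coassoc; last first.
  split=> [a|a a' b g|k a b g].
  - split=> [b b' g|b g g'|b k g]; first by rewrite antipodeD mulrDr p1.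
      by rewrite p2.
    by rewrite -p3 antipodeZ scalerAr.
  - by rewrite mulrDl p1.
  - by rewrite antipodeZ -scalerAl scalerAr.
transitivity (tlift (fun a f0 => psi 1 (eps a *: f0)) (rho f)).
  apply: eq_tlift => a f0.
  rewrite -(tlift_morph (h := psi^~ f0)); last by move=> b b'; apply: p1.
  by rewrite (antipode_r hA) p3.
by rewrite (comodule_counit (h := psi 1)).
Qed.

End Comodules.
Section TensorMaps.
Context {K : comPzRingType}.
Implicit Types V W : lmodType K.

Lemma tensDl V W (v v' : V) (w : W) : (v + v') ⊗ w = v ⊗ w + v' ⊗ w.
Proof. by case: (tens_balanced V W). Qed.

Lemma tensDr V W (v : V) (w w' : W) : v ⊗ (w + w') = v ⊗ w + v ⊗ w'.
Proof. by case: (tens_balanced V W). Qed.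

Lemma tensZl V W k (v : V) (w : W) : (k *: v) ⊗ w = k *: (v ⊗ w).
Proof. by rewrite -[RHS]/(tscale k (v ⊗ w)) tscaleE. Qed.

Lemma tensZr V W k (v : V) (w : W) : v ⊗ (k *: w) = k *: (v ⊗ w).
Proof. by rewrite -tensZl; case: (tens_balanced V W) => _ _ ->. Qed.

Lemma tens_linear V W (v : V) : linear (fun w : W => v ⊗ w).
Proof. by move=> k w w'; rewrite tensDr tensZr. Qed.

Lemma tens0r V W (v : V) : v ⊗ (0 : W) = 0.
Proof. exact: linear_zero (tens_linear v). Qed.

Lemma tensBr V W (v : V) (w w' : W) : v ⊗ (w - w') = v ⊗ w - v ⊗ w'.
Proof. by rewrite tensDr (linear_opp (tens_linear v)). Qed.

Lemma tens_sumr V W (v : V) (I : Type) (s : seq I) (Q : pred I) (g : I -> W) :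
  v ⊗ (\sum_(i <- s | Q i) g i) = \sum_(i <- s | Q i) v ⊗ g i.
Proof. exact: (linear_bigsum (tens_linear v) s Q g). Qed.

Section Map.
Context {V W W' : lmodType K} {g : W -> W'}.
Hypothesis hg : linear g.

Lemma tmap_balanced : cbalanced (fun (v : V) w => v ⊗ g w).
Proof.
apply: bilinear_balanced => [w|v] k x y; first by rewrite tensDl tensZl.
by rewrite hg tensDr tensZr.
Qed.

Lemma tmap_tens (v : V) w : tmap id g (v ⊗ w) = v ⊗ g w.
Proof. by rewrite /tmap tliftE //; apply: tmap_balanced. Qed.

Lemma tmap_sum (s : seq (V * W)) :
  tmap id g (\sum_(p <- s) p.1 ⊗ p.2) = \sum_(p <- s) p.1 ⊗ g p.2.
Proof. by rewrite /tmap tlift_sum //; apply: tmap_balanced. Qed.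

Lemma tmap_linear : linear (tmap (id : V -> V) g).
Proof.
move=> k x y; have [s ->] := tensor_sum x; have [t ->] := tensor_sum y.
have -> : k *: (\sum_(p <- s) p.1 ⊗ p.2) + \sum_(p <- t) p.1 ⊗ p.2 =
    \sum_(p <- [seq (k *: p.1, p.2) | p <- s] ++ t) p.1 ⊗ p.2.
  rewrite big_cat big_map scaler_sumr; congr (_ + _).
  by apply: eq_bigr => p _; rewrite tensZl.
rewrite !tmap_sum big_cat big_map scaler_sumr; congr (_ + _).
by apply: eq_bigr => p _; rewrite tensZl.
Qed.

End Map.

Lemma tmul_sum (A D : algType K) (s t : seq (A * D)) :
  tmul (\sum_(p <- s) p.1 ⊗ p.2) (\sum_(q <- t) q.1 ⊗ q.2)
  = \sum_(p <- s) \sum_(q <- t) (p.1 * q.1) ⊗ (p.2 * q.2).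
Proof.
have hb (a : A) (c : D) : cbalanced (fun (b : A) (e : D) => (a * b) ⊗ (c * e)).
  apply: bilinear_balanced => [w|v] k x y.
    by rewrite mulrDr -scalerAr tensDl tensZl.
  by rewrite mulrDr -scalerAr tensDr tensZr.
rewrite /tmul tlift_sum; first by apply: eq_bigr => p _; rewrite tlift_sum.
apply: bilinear_balanced => [w|v] k x y; rewrite !tlift_sum //.
  rewrite scaler_sumr -big_split; apply: eq_bigr => p _ /=.
  by rewrite mulrDl -scalerAl tensDl tensZl.
rewrite scaler_sumr -big_split; apply: eq_bigr => p _ /=.
by rewrite mulrDl -scalerAl tensDr tensZr.
Qed.

End TensorMaps.
(** * A finite frame for a covariant nondegenerate pairing *)
Definition linear_of (K : pzRingType) (V W : lmodType K) (f : V -> W)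
    (hf : linear f) : {linear V -> W} :=
  HB.pack f (GRing.isLinear.Build K V W *:%R f hf).

Section Frame.
Context {R : realType}.
Local Notation C := R[i].
Context {A : algType C} {Delta : A -> A ⊗ A} {eps : A -> C} {S starA : A -> A}.
Hypothesis hA : hopf_star_algebra Delta eps S starA.
Context {P : {pred A}} {B : subAlgType P}.
Hypothesis hff : faithfully_flat (fun (a : A) (b : B) => a * val b).
Context {Om : algType C} {j : {lrmorphism B -> Om}} {rho : Om -> (A ⊗ Om)%type}.
Hypothesis hrho : left_comodule Delta eps rho.
Hypothesis hfg : fin_gen (fun (b : B) (w : Om) => j b * w).
Hypothesis hract : forall f b, exists2 t : (B ⊗ Om)%type,
  tmap (val : B -> A) id t =
    tlift (fun a f0 =>
      tlift (fun a1 a2 => (a1 * val b * S a2) ⊗ f0) (Delta a)) (rho f)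
  & f * j b = tlift (fun b w => j b * w) t.
Context {starB : B -> B} {star : Om -> Om}.
Hypothesis hstar : conj_involution star.
Hypothesis starM : forall b w, star (j b * w) = star w * j (starB b).

Context {tau : Om -> Om -> B}.
Hypothesis tauDl : forall f f' z, tau (f + f') z = tau f z + tau f' z.
Hypothesis tauDr : forall f z z', tau f (z + z') = tau f z + tau f z'.
Hypothesis tauMl : forall b f z, tau (j b * f) z = b * tau f z.
Hypothesis tauMr : forall f z b, tau f (z * j b) = tau f z * b.
Hypothesis tauMm : forall f b z, tau (f * j b) z = tau f (j b * z).
Hypothesis tau_star : forall f z,
  val (tau f z) = starA (val (tau (star z) (star f))).
Hypothesis tau_cov : forall f z,
  val (tau f z) = tlift (fun a f0 => tlift (fun c z0 =>
     eps (val (tau f0 z0)) *: (a * c)) (rho z)) (rho f).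
Hypothesis tau_nondeg : forall f, tau f (star f) = 0 -> f = 0.

Let hH := hsa_hopf hA.

Lemma jZ k (w : Om) : k *: w = j (k *: 1) * w.
Proof. by rewrite linearZ /= rmorph1 -scalerAl mul1r. Qed.

Lemma jZr k (w : Om) : k *: w = w * j (k *: 1).
Proof. by rewrite linearZ /= rmorph1 -scalerAr mulr1. Qed.

Lemma tauZl k f z : tau (k *: f) z = k *: tau f z.
Proof. by rewrite jZ tauMl -scalerAl mul1r. Qed.

Lemma tauZr k f z : tau f (k *: z) = k *: tau f z.
Proof. by rewrite jZr tauMr -scalerAr mulr1. Qed.

Lemma tau_linl z : linear (tau^~ z).
Proof. by move=> k f f'; rewrite tauDl tauZl. Qed.

Lemma tau_linr f : linear (tau f).
Proof. by move=> k f' f''; rewrite tauDr tauZr. Qed.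

Lemma eps_antipode a : eps (S a) = eps a.
Proof.
have epsD := linear_add (eps_linear hH).
have epsZ k b : eps (k *: b) = k * eps b := linear_scale (eps_linear hH) k b.
have := congr1 eps (antipode_l hH a).
rewrite epsZ (eps_one hH) mulr1 => <-; rewrite (tlift_morph _ _ epsD).
rewrite -[in LHS](counit_r hH a) (tlift_morph _ _ (antipodeD hH)).
rewrite (tlift_morph _ _ epsD); apply: eq_tlift => x y.
by rewrite (antipodeZ hH) epsZ (eps_mul hH) mulrC.
Qed.

Definition beta f z : C := eps (val (tau f z)).

Lemma beta_linl z : linear ((beta^~ z) : Om -> C^o).
Proof. by move=> k f f'; rewrite /beta tau_linl linearP (eps_linear hH). Qed.

Lemma beta_linr f : linear ((beta f) : Om -> C^o).
Proof. by move=> k f' f''; rewrite /beta tau_linr linearP (eps_linear hH). Qed.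

Lemma betaMl b f z : beta (j b * f) z = eps (val b) * beta f z.
Proof. by rewrite /beta tauMl rmorphM (eps_mul hH). Qed.

(** Left linearity in the second slot is not formal: by balancedness it is
    left linearity through a right multiplication, which the bimodule formula
    f b = f_(-2) b S(f_(-1)) f_0 turns into eps(b) after applying eps. *)
Lemma betaMr b f z : beta f (j b * z) = eps (val b) * beta f z.
Proof.
have epsD := linear_add (eps_linear hH).
have epsZ k c : eps (k *: c) = k * eps c := linear_scale (eps_linear hH) k c.
have bD := linear_add (beta_linl z).
rewrite {1}/beta -tauMm -/(beta _ z).
have [t ht ->] := hract f b.
rewrite (tlift_morph _ _ bD).
have hb : cbalanced (fun (a : A) w => eps a * beta w z).
  apply: (bilinear_balanced (Z := C^o)) => [w|a] k x y /=.
    by rewrite epsD epsZ mulrDl -mulrA.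
  by rewrite (beta_linl z) mulrDr /GRing.scale /= mulrCA.
transitivity (tlift (fun (a : A) w => eps a * beta w z) (tmap val id t)).
  rewrite /tmap (tlift_comp _ _ hb); apply: eq_tlift => b' w.
  by rewrite tliftE // betaMl.
rewrite ht (tlift_comp _ _ hb).
transitivity (tlift (fun a f0 => eps (val b) * beta (eps a *: f0) z) (rho f)).
  apply: eq_tlift => a f0; rewrite (tlift_comp _ _ hb).
  transitivity (eps (val b) *
      tlift (fun a1 a2 => eps (a1 * S a2) * beta f0 z) (Delta a)).
    rewrite (tlift_morph (h := fun c => eps (val b) * c)); last exact: mulrDr.
    apply: eq_tlift => a1 a2; rewrite tliftE // !(eps_mul hH) !mulrA.
    by rewrite [eps a1 * _]mulrC.
  congr (_ * _); have := congr1 eps (antipode_r hH a).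
  rewrite (linear_scale (beta_linl z)) epsZ (eps_one hH) mulr1 => <-.
  rewrite (tlift_morph _ _ epsD) -[_ *: _]/(_ * _).
  by rewrite (tlift_morph (h := fun c => c * beta f0 z)) // => x y; rewrite mulrDl.
rewrite (comodule_counit hrho (h := fun g => eps (val b) * beta g z)) //.
by move=> x y; rewrite bD mulrDr.
Qed.

Lemma beta_star f z : beta f z = (beta (star z) (star f))^*.
Proof. by rewrite /beta tau_star (eps_star hA). Qed.

(** S(f_(-1)) tau(f_0, z) = z_(-1) beta(f, z_0): covariance of tau with the
    first factor cancelled. *)
Lemma tau_antipode f z :
  tlift (fun a f0 => S a * val (tau f0 z)) (rho f)
  = tlift (fun c z0 => beta f z0 *: c) (rho z).
Proof.
pose psi (x : A) f1 := tlift (fun c z0 => beta f1 z0 *: (x * c)) (rho z).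
have hpsi : cbalanced psi.
  apply: bilinear_balanced => [f1|x] k y y'; rewrite /psi.
    rewrite (tlift_morph (h := fun v => k *: v)) -?tlift_addf; last exact: scalerDr.
    apply: eq_tlift => c z0.
    by rewrite mulrDl scalerDr -scalerAl !scalerA [k * _]mulrC.
  rewrite (tlift_morph (h := fun v => k *: v)) -?tlift_addf; last exact: scalerDr.
  by apply: eq_tlift => c z0; rewrite beta_linl scalerDl scalerA.
transitivity (psi 1 f); last by apply: eq_tlift => c z0; rewrite mul1r.
rewrite -(antipode_cancel_l hrho hH f hpsi); apply: eq_tlift => a f0.
rewrite tau_cov (tlift_morph (h := fun v => S a * v)); last exact: mulrDr.
apply: eq_tlift => a1 f1; rewrite (tlift_morph (h := fun v => S a * v)).
  by apply: eq_tlift => c z0; rewrite -scalerAr mulrA.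
exact: mulrDr.
Qed.

Local Notation M := (restr_mod j).
Local Notation ra := (fun (a : A) (b : B) => a * val b).
Local Notation bt N := (btens ra (fun (b : B) (m : N) => b *: m)).

Lemma btDl (N : lmodType B) a a' m : bt N (a + a') m = bt N a m + bt N a' m.
Proof. by case: (btens_balanced ra (fun (b : B) (m : N) => b *: m)). Qed.

Lemma btDr (N : lmodType B) a m m' : bt N a (m + m') = bt N a m + bt N a m'.
Proof. by case: (btens_balanced ra (fun (b : B) (m : N) => b *: m)). Qed.

Lemma btM (N : lmodType B) a b m : bt N (a * val b) m = bt N a (b *: m).
Proof. by case: (btens_balanced ra (fun (b : B) (m : N) => b *: m)). Qed.

Lemma bt0l (N : lmodType B) m : bt N 0 m = 0.
Proof. by apply: (addrI (bt N 0 m)); rewrite -btDl !addr0. Qed.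

Lemma btZ k a (m : Om) : bt M (k *: a) m = bt M a (k *: m).
Proof.
rewrite jZ -[RHS]/(bt M a ((k *: 1 : B) *: (m : M))) -btM linearZ /= rmorph1.
by rewrite -scalerAr mulr1.
Qed.

Lemma bt_balanced (c : A) : cbalanced (fun (y : A) (w : Om) => bt M (c * y) w).
Proof.
split=> [y y' w|y w w'|y k w]; first by rewrite mulrDr btDl.
  by rewrite -btDr.
by rewrite -btZ scalerAr.
Qed.

(** a s(z), where s(z) = S(z_(-1)) (x) z_0 is the coinvariant element of the
    Hopf module attached to z. *)
Definition coinv (a : A) (z : Om) := tlift (fun x z0 => bt M (a * S x) z0) (rho z).

Lemma coinv_inner_balanced a :
  cbalanced (fun (x : A) (w : Om) => bt M (a * S x) w).
Proof.
split=> [y y' w|y w w'|y k w]; first by rewrite (antipodeD hH) mulrDr btDl.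
  by rewrite -btDr.
by rewrite (antipodeZ hH) -btZ scalerAr.
Qed.

Lemma coinvDl a a' z : coinv (a + a') z = coinv a z + coinv a' z.
Proof. by rewrite -tlift_addf; apply: eq_tlift => x w; rewrite mulrDl btDl. Qed.

Lemma coinvDr a z z' : coinv a (z + z') = coinv a z + coinv a z'.
Proof.
by rewrite /coinv (linear_add (rho_linear hrho)) tliftD //;
  apply: coinv_inner_balanced.
Qed.

Lemma coinvZ k a z : coinv (k *: a) z = coinv a (k *: z).
Proof.
rewrite /coinv (linear_scale (rho_linear hrho)) tliftZ; last first.
  exact: coinv_inner_balanced.
apply: eq_tlift => x w.
by rewrite (antipodeZ hH) -scalerAl scalerAr.
Qed.

Lemma coinv_unit a z : tlift (fun x z0 => coinv (a * x) z0) (rho z) = bt M a z.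
Proof.
rewrite -{2}[a]mulr1 -(antipode_cancel_r hrho hH z (bt_balanced a)).
by apply: eq_tlift => x z0; apply: eq_tlift => y z1; rewrite mulrA.
Qed.

Lemma rmul_linear b : linear ((fun w : Om => w * j b) : M -> M).
Proof.
move=> c w w'; rewrite -[c *: w]/(j c * (w : Om)) -[c *: _]/(j c * (_ : Om)).
by rewrite mulrDl mulrA.
Qed.

Definition rmul b : {linear M -> M} := linear_of (rmul_linear b).

(** s(z) b = b s(z): expanding z_0 b by the bimodule formula produces
    S(z_(-3)) z_(-2) b S(z_(-1)) (x) z_0, in which the first two factors
    cancel. *)
Lemma coinv_rmul a z b :
  bmap ra (rmul b) (coinv a z) = coinv (a * val b) z.
Proof.
rewrite /coinv (tlift_morph _ _ (btensor_mapD (rmul b))).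
pose psi (u : A) z' := tlift (fun y z1 => bt M (a * (u * val b * S y)) z1) (rho z').
have hth (c : A) (g : A -> A) : linear g ->
    trilinear (fun x y z1 => bt M (c * (g x * val b * S y)) z1).
  move=> hg; split=> [x|x x' y z1|k x y z1].
  - split=> [y y' w|y w w'|y k w]; first by rewrite (antipodeD hH) !mulrDr btDl.
      by rewrite -btDr.
    by rewrite (antipodeZ hH) -btZ !scalerAr.
  - by rewrite (linear_add hg) !mulrDl mulrDr btDl.
  - by rewrite (linear_scale hg) (antipodeZ hH) -!scalerAl !scalerAr.
have hid : linear (id : A -> A) by [].
have hpsi : cbalanced psi.
  exact: (trilinear_tlift (hth a id hid) (rho_linear hrho)).
transitivity (psi 1 z); last first.
  by apply: eq_tlift => y z1; rewrite mul1r mulrA.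
rewrite -(antipode_cancel_l hrho hH z hpsi); apply: eq_tlift => x0 z0.
rewrite btensor_mapE /=.
have [t ht ->] := hract z0 b.
have hb := bt_balanced (a * S x0).
have -> : bt M (a * S x0) (tlift (fun b w => j b * w) t)
    = tlift (fun b' w => bt M (a * S x0 * val b') w) t.
  rewrite (tlift_morph (h := fun w : Om => bt M (a * S x0) w)); last first.
    by move=> w w'; apply: btDr.
  by apply: eq_tlift => b' w; rewrite btM.
have -> : tlift (fun b' w => bt M (a * S x0 * val b') w) t
    = tlift (fun y w => bt M (a * S x0 * y) w) (tmap val id t).
  by rewrite /tmap (tlift_comp _ _ hb); apply: eq_tlift => b' w; rewrite tliftE.
rewrite ht (tlift_comp _ _ hb).
transitivity (tlift (fun a1 z1 => tlift (fun x y =>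
    bt M (a * S x0 * (x * val b * S y)) z1) (Delta a1)) (rho z0)).
  apply: eq_tlift => a1 z1; rewrite (tlift_comp _ _ hb).
  by apply: eq_tlift => x y; rewrite tliftE.
rewrite (comodule_coassoc hrho _ (hth (a * S x0) id hid)).
by apply: eq_tlift => x z'; apply: eq_tlift => y z1; rewrite !mulrA.
Qed.

Lemma right_generators : exists (r : nat) (e : 'I_r -> Om),
  (forall w, exists c : 'I_r -> B, w = \sum_(i < r) j (c i) * e i) /\
  (forall w, exists c : 'I_r -> B, w = \sum_(i < r) star (e i) * j (c i)).
Proof.
have [r [e he]] := hfg; exists r, e; split=> // w.
have sD : {morph star : a b / a + b}.
  move=> x y; have := conj_inv_lin hstar 1 x y.
  by rewrite rmorph1 !scale1r.
have s0 : star 0 = 0 by apply: (addrI (star 0)); rewrite -sD !addr0.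
have [c hc] := he (star w); exists (fun i => starB (c i)).
rewrite -[w](conj_inv_invol hstar) hc (big_morph _ sD s0).
by apply: eq_bigr => i _; rewrite starM.
Qed.

Definition ffinj (N : lmodType B) (I : finType) (i : I) (m : N) : {ffun I -> N} :=
  [ffun i' => if i' == i then m else 0].

Lemma ffinj_linear (N : lmodType B) (I : finType) (i : I) :
  linear (@ffinj N I i).
Proof.
move=> c m m'; apply/ffunP => i'; rewrite !ffunE; case: ifP => // _.
by rewrite scaler0 addr0.
Qed.

Definition ffinjL (N : lmodType B) (I : finType) (i : I) :
  {linear N -> {ffun I -> N}} := linear_of (@ffinj_linear N I i).

Lemma ffinj_sum (N : lmodType B) (I : finType) (v : {ffun I -> N}) :
  v = \sum_i ffinj i (v i).
Proof.
apply/ffunP => i; rewrite sum_ffunE (bigD1 i) //= ffunE eqxx big1 ?addr0 //.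
by move=> i' ne; rewrite ffunE eq_sym (negPf ne).
Qed.

Lemma bt_sumr (N : lmodType B) a (I : finType) (g : I -> N) :
  bt N a (\sum_i g i) = \sum_i bt N a (g i).
Proof.
apply: (big_morph (fun m => bt N a m) (id1 := 0)) => [m m'|].
  exact: btDr.
exact: (btens0r ra).
Qed.

(** The functionals tau(-, star e_l) embed the forms in a free module of finite
    rank; this stays injective over A, and there the image of a s(z) has
    coordinates a S(z_(-1)) tau(z_0, star e_l), which [tau_antipode] expresses
    through beta(z, -). *)
Lemma coinv_null a z : (forall y, beta z y = 0) -> coinv a z = 0.
Proof.
move=> hz; have [r [e [_ he]]] := right_generators.
pose th (f : M) : {ffun 'I_r -> B^o} := [ffun l => tau f (star (e l))].
have thL : linear th.
  move=> c f f'; apply/ffunP => l; rewrite !ffunE tauDl.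
  by rewrite -[c *: f]/(j c * (f : Om)) tauMl.
apply: (flat_inj hff (f := linear_of thL)).
  move=> f f' /= ff'; apply/eqP; rewrite -subr_eq0; apply/eqP; apply: tau_nondeg.
  have [c ->] := he (star (f - f' : Om)).
  rewrite (linear_bigsum (tau_linr _)) big1 // => i _.
  rewrite tauMr tauDl (linear_opp (tau_linl (star (e i)))).
  have /ffunP/(_ i) := ff'; rewrite !ffunE => ->.
  by rewrite subrr mul0r.
rewrite /coinv (tlift_morph _ _ (btensor_mapD (linear_of thL))).
transitivity (\sum_(l < r) bt {ffun 'I_r -> B^o}
   (a * tlift (fun x z0 => S x * val (tau z0 (star (e l)))) (rho z))
   (ffinj l (1 : B^o))).
  transitivity (tlift (fun x z0 => \sum_(l < r) bt {ffun 'I_r -> B^o}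
     (a * (S x * val (tau z0 (star (e l))))) (ffinj l (1 : B^o))) (rho z)).
    apply: eq_tlift => x z0; rewrite btensor_mapE [X in btens _ _ _ X]ffinj_sum.
    rewrite bt_sumr; apply: eq_bigr => l _; rewrite mulrA btM; congr btens.
    apply/ffunP => i; rewrite !ffunE; case: ifP => _; rewrite ?scaler0 //.
    by rewrite /GRing.scale /= mulr1.
  rewrite tlift_sumf; apply: eq_bigr => l _.
  rewrite (tlift_morph
    (h := fun v => bt {ffun 'I_r -> B^o} (a * v) (ffinj l (1 : B^o)))) //.
  by move=> x y; rewrite mulrDr btDl.
apply: big1 => l _; rewrite tau_antipode.
rewrite (eq_tlift (gamma := fun _ _ => 0)) ?tlift_0f ?mulr0 ?bt0l //.
by move=> v w; rewrite hz scale0r.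
Qed.

(** The functional a (x) m |-> eps(a) beta(y, m) is balanced over B by
    [betaMr], and sends s(z) to beta(y, z). *)
Lemma coinv_null_beta z : coinv 1 z = 0 -> forall y, beta y z = 0.
Proof.
move=> h0 y.
have epsZ k c : eps (k *: c) = k * eps c := linear_scale (eps_linear hH) k c.
have hb : balanced ra (fun (b : B) (m : M) => b *: m)
    (fun a m => eps a * beta y m).
  split=> [a a' m|a m m'|a b m].
  - by rewrite (linear_add (eps_linear hH)) mulrDl.
  - by rewrite (linear_add (beta_linr y)) mulrDr.
  - by rewrite betaMr (eps_mul hH) mulrA.
have := congr1 (blift (fun a m => eps a * beta y m)) h0.
rewrite /coinv (tlift_morph (h := blift (fun a m => eps a * beta y m))); last first.
  by move=> t t'; apply: bliftD.
have -> : blift (fun a (m : M) => eps a * beta y m)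
     (0 : btensor ra (fun (b : B) (m : M) => b *: m)) = 0.
  by rewrite -(bt0l (0 : M)) bliftE // (linear_zero (eps_linear hH)) mul0r.
rewrite (eq_tlift (gamma := fun a z0 => beta y (eps a *: z0))); last first.
  move=> x z0; rewrite bliftE // mul1r eps_antipode.
  by rewrite (linear_scale (beta_linr y)).
by rewrite (comodule_counit hrho (h := beta y)) //; apply: linear_add (beta_linr y).
Qed.

(** [coinv_null] and [coinv_null_beta] put the left radical inside the right
    one; star exchanges the two. *)
Lemma beta_radical z : (forall y, beta y z = 0) -> forall y, beta z y = 0.
Proof.
move=> hz y; have h1 y' : beta (star z) y' = 0.
  by rewrite beta_star (conj_inv_invol hstar) hz rmorph0.
by rewrite beta_star (coinv_null_beta (coinv_null 1 h1)) rmorph0.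
Qed.

(** With X the Gram matrix of the generators and D a generalized inverse of it,
    this is the identity X D X = X. *)
Lemma beta_frame (r : nat) (e : 'I_r -> Om) :
  (forall w, exists c : 'I_r -> B, w = \sum_(i < r) j (c i) * e i) ->
  exists v : 'I_r -> Om,
    forall y z, beta y z = \sum_(k < r) beta (e k) z * beta y (v k).
Proof.
move=> he; pose X := \matrix_(k < r, i < r) beta (e k) (e i).
pose D := pinvmx X.
exists (fun k => \sum_(i < r) D i k *: e i) => y z.
have [c hc] := he z; have [d hd] := he y.
pose cv := \col_(i < r) eps (val (c i)).
pose dv := \row_(i < r) eps (val (d i)).
have bl i : beta y (e i) = (dv *m X) 0 i.
  rewrite hd (linear_bigsum (beta_linl (e i))) !mxE; apply: eq_bigr => k _.
  by rewrite betaMl !mxE.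
have br k : beta (e k) z = (X *m cv) k 0.
  rewrite hc (linear_bigsum (beta_linr (e k))) !mxE; apply: eq_bigr => i _.
  by rewrite betaMr !mxE mulrC.
transitivity ((dv *m X *m cv) 0 0).
  rewrite hc (linear_bigsum (beta_linr y)) mxE; apply: eq_bigr => i _.
  by rewrite betaMr -bl !mxE mulrC.
have -> : dv *m X *m cv = dv *m X *m D *m (X *m cv).
  by rewrite -{1}(mulmxKpV (submx_refl X)) !mulmxA.
rewrite mxE.
apply: eq_bigr => k _; rewrite -br mulrC; congr (_ * _).
rewrite (linear_bigsum (beta_linr y)) mxE; apply: eq_bigr => i _.
by rewrite (linear_scale (beta_linr y)) bl mulrC.
Qed.

(** s(z) = sum_k beta(e_k, z) s(v_k), inserted in 1 (x) z = z_(-1) s(z_0), with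
    z_(-1) beta(e_k, z_0) replaced by S(e_k_(-1)) tau(e_k_0, z).  The list
    consists of the triples of e_k_(-1), e_k_0 and v_k. *)
Lemma coinv_frame : exists s : seq (A * Om * Om),
  forall a z, bt M a z = \sum_(t <- s) coinv (a * (S t.1.1 * val (tau t.1.2 z))) t.2.
Proof.
have [r [e [he _]]] := right_generators.
have [v hv] := beta_frame he.
have [s hs] := boolp.choice (fun k => tensor_sum (rho (e k))).
exists (flatten [seq [seq (p, v k) | p <- s k] | k <- enum 'I_r]) => a z.
have coinv0l y : coinv 0 y = 0.
  by apply: (addrI (coinv 0 y)); rewrite -coinvDl !addr0.
have coinv0r c : coinv c 0 = 0.
  by apply: (addrI (coinv c 0)); rewrite -coinvDr !addr0.
have coinvE c y : coinv c y = \sum_(k < r) coinv (beta (e k) y *: c) (v k).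
  transitivity (coinv c (\sum_(k < r) beta (e k) y *: v k)); last first.
    rewrite (big_morph (coinv c) (coinvDr c) (coinv0r c)).
    by apply: eq_bigr => k _; rewrite coinvZ.
  rewrite -[y in LHS](subrK (\sum_(k < r) beta (e k) y *: v k)) coinvDr.
  rewrite coinv_null ?add0r //; apply: beta_radical => y'.
  rewrite (linear_add (beta_linr y')) (linear_opp (beta_linr y')).
  rewrite (linear_bigsum (beta_linr y')) hv; apply/eqP; rewrite subr_eq0; apply/eqP.
  by apply: eq_bigr => k _; rewrite (linear_scale (beta_linr y')).
rewrite -coinv_unit.
under eq_tlift do rewrite coinvE.
rewrite tlift_sumf big_flatten big_map big_enum /=; apply: eq_bigr => k _.
rewrite big_map.
transitivity (coinv (a * tlift (fun c z0 => beta (e k) z0 *: c) (rho z)) (v k)).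
  rewrite (tlift_morph (h := fun c => coinv (a * c) (v k))); last first.
    by move=> c c'; rewrite mulrDr coinvDl.
  by apply: eq_tlift => c z0; rewrite scalerAr.
rewrite -tau_antipode hs tlift_sum.
  rewrite mulr_sumr.
  by rewrite (big_morph (coinv^~ (v k)) (fun c c' => coinvDl c c' _) (coinv0l _)).
apply: bilinear_balanced => [w|c] k' c' c''.
  by rewrite (S_linear hH) mulrDl scalerAl.
by rewrite tau_linl linearP /= mulrDr scalerAr.
Qed.

(** The unknowns y_i must satisfy sum_i y_i tau(x_i, z) = z for z among the
    finitely many right generators, which suffices by right linearity.  This is
    a left B-linear equation; by [coinv_rmul] the elements a_i s(v_i) of
    [coinv_frame] solve it over A. *)
Lemma tau_frame : exists s : seq (Om * Om),
  forall z, z = \sum_(p <- s) p.2 * j (tau p.1 z).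
Proof.
have [r [e [_ he]]] := right_generators.
have [s hs] := coinv_frame.
pose q := size s; pose t0 : A * Om * Om := (0, 0, 0).
pose g (i : 'I_q) := nth t0 s i.
have hg a z : bt M a z
    = \sum_(i < q) coinv (a * (S (g i).1.1 * val (tau (g i).1.2 z))) (g i).2.
  by rewrite hs (big_nth t0) big_mkord.
pose u (zeta : {ffun 'I_q -> M}) : {ffun 'I_r -> M} :=
  [ffun l => \sum_(i < q) rmul (tau (g i).1.2 (star (e l))) (zeta i)].
have uL : linear u.
  move=> c x y; apply/ffunP => l; rewrite !ffunE scaler_sumr -big_split.
  by apply: eq_bigr => i _; rewrite !ffunE linearP.
pose y : {ffun 'I_r -> M} := [ffun l => star (e l)].
(* [u] sends the unknowns to the left-hand sides of the equations, [y] collects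
   the right-hand sides. *)
have [a|zeta hz] := ff_descent hff (u := linear_of uL) (y := y).
  exists (\sum_(i < q) bmap ra (ffinjL M i) (coinv (a * S (g i).1.1) (g i).2)).
  rewrite (big_morph _ (btensor_mapD (linear_of uL)) (btensor_map0 ra (linear_of uL))).
  have step i (t : btensor ra (fun (b : B) (m : M) => b *: m)) :
      bmap ra (linear_of uL) (bmap ra (ffinjL M i) t)
      = \sum_(l < r) bmap ra (ffinjL M l)
          (bmap ra (rmul (tau (g i).1.2 (star (e l)))) t).
    move: t; apply: (@btensor_ind B) => [c m|t t' ht ht'|]; last first.
    - by rewrite !btensor_map0 big1 // => l _; rewrite !btensor_map0.
    - rewrite !btensor_mapD ht ht' -big_split; apply: eq_bigr => l _.
      by rewrite !btensor_mapD.
    rewrite !btensor_mapE [X in btens _ _ _ X]ffinj_sum bt_sumr.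
    apply: eq_bigr => l _; rewrite !btensor_mapE; congr (btens _ _ _ (ffinj _ _)).
    rewrite ffunE (bigD1 i) //= ffunE eqxx big1 ?addr0 // => i' ne.
    by rewrite ffunE (negPf ne) mul0r.
  under eq_bigr do rewrite step.
  rewrite exchange_big [y]ffinj_sum bt_sumr; apply: eq_bigr => l _.
  rewrite -(btensor_mapE ra (ffinjL M l)) ffunE hg.
  rewrite (big_morph _ (btensor_mapD (ffinjL M l)) (btensor_map0 ra (ffinjL M l))).
  by apply: eq_bigr => i _; rewrite coinv_rmul mulrA.
exists [seq ((g i).1.2, zeta i : Om) | i <- enum 'I_q] => z.
have [c ->] := he z; rewrite big_map big_enum /=.
under [RHS]eq_bigr do rewrite (linear_bigsum (tau_linr _)) rmorph_sum mulr_sumr.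
rewrite exchange_big; apply: eq_bigr => l _.
have /ffunP/(_ l) := hz; rewrite !ffunE /= => hl.
under eq_bigr do rewrite tauMr rmorphM mulrA.
by rewrite -mulr_suml hl.
Qed.

End Frame.
(** * Components of a grading *)
Section Subspaces.
Context {K : nzRingType} {V : lmodType K} {Q : set V}.
Hypothesis hQ : is_subspace Q.

Lemma subspaceD u v : Q u -> Q v -> Q (u + v).
Proof. by move=> hu hv; rewrite -[u]scale1r; apply: hQ.2. Qed.

Lemma subspaceZ c u : Q u -> Q (c *: u).
Proof. by move=> hu; rewrite -[_ *: _]addr0; apply: hQ.2 => //; apply: hQ.1. Qed.

Lemma subspaceB u v : Q u -> Q v -> Q (u - v).
Proof.
by move=> hu hv; rewrite -scaleN1r; apply: subspaceD => //; apply: subspaceZ.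
Qed.

Lemma subspace_sum (I : Type) (s : seq I) (p : pred I) (f : I -> V) :
  (forall i, p i -> Q (f i)) -> Q (\sum_(i <- s | p i) f i).
Proof.
move=> hf; elim/big_ind: _ => //; first exact: hQ.1.
by move=> *; apply: subspaceD.
Qed.

End Subspaces.

Section Gradings.
Context {K : nzRingType} {V : lmodType K} {I : choiceType} {deg : I -> set V}.
Hypothesis hdeg : direct_sum deg.
Local Notation comp := (component deg).

Lemma decomposesP v f : decomposes deg v f <->
  (forall i, deg i (f i)) /\ exists s : seq I,
    [/\ uniq s, forall i, i \notin s -> f i = 0 & v = \sum_(i <- s) f i].
Proof.
have sumE s : uniq s -> (forall i, i \notin s -> f i = 0) ->
    \big[+%R/0]_(i \in [set: I]) f i = \sum_(i <- s) f i.
  move=> us hs; rewrite (fsbigE s) //; last by move=> i _; apply: hs.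
  by apply: eq_bigl => i; rewrite in_setT.
split=> [[h1 /finite_seqP[s hs] ->]|[h1 [s [us hs ->]]]].
  split=> //; exists (undup s); have hs' i : i \notin undup s -> f i = 0.
    rewrite mem_undup => /negP his; apply/eqP/negPn/negP => fi.
    apply: his; suff : [set` s]%classic i by [].
    by rewrite -hs.
  by split; rewrite ?undup_uniq // (sumE (undup s)) ?undup_uniq.
split=> //; last by rewrite (sumE s).
apply: (sub_finite_set (B := [set` s])); last exact: finite_seq.
by move=> i /= fi; apply: contraR fi => /hs ->.
Qed.

Lemma sum_widen (f : I -> V) (s s' : seq I) : uniq s -> uniq s' ->
  {subset s <= s'} -> (forall i, i \notin s -> f i = 0) ->
  \sum_(i <- s) f i = \sum_(i <- s') f i.
Proof.
move=> us us' ss hs.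
rewrite [RHS](bigID (mem s)) /= [X in _ + X]big1 ?addr0; last by [].
rewrite -[RHS]big_filter; apply: perm_big; apply: uniq_perm => //.
  exact: filter_uniq.
by move=> i; rewrite mem_filter /=; case: (boolP (i \in s)) => // /ss ->.
Qed.

Lemma component_unique v f i : decomposes deg v f -> comp i v = f i.
Proof.
move=> hf; have [g [_ gu]] := hdeg.2 v.
apply: xget_unique; first by exists f.
by move=> y [f' hf' ->]; rewrite -(gu _ hf) -(gu _ hf').
Qed.

Lemma component_decomposes v : decomposes deg v (comp^~ v).
Proof.
have [f [hf _]] := hdeg.2 v.
by rewrite (_ : comp^~ v = f) //; apply/funext => i; apply: component_unique.
Qed.

Lemma component_deg i v : deg i (comp i v).
Proof. by case: (component_decomposes v). Qed.

Lemma component_id i v : deg i v -> comp i v = v.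
Proof.
move=> hv; have := @component_unique v (fun k => if k == i then v else 0) i.
rewrite eqxx; apply; apply/decomposesP; split=> [k|].
  by case: eqP => [->//|_]; apply: (hdeg.1 k).1.
exists [:: i]; split=> //; last by rewrite big_seq1 eqxx.
by move=> k; rewrite inE => /negPf->.
Qed.

Lemma component_other i k v : deg i v -> k != i -> comp k v = 0.
Proof.
move=> hv ne; have := @component_unique v (fun k => if k == i then v else 0) k.
rewrite (negPf ne); apply; apply/decomposesP; split=> [l|].
  by case: eqP => [->//|_]; apply: (hdeg.1 l).1.
exists [:: i]; split=> //; last by rewrite big_seq1 eqxx.
by move=> l; rewrite inE => /negPf->.
Qed.

Lemma component_linear i : linear (comp i).
Proof.
move=> c u v.
have /decomposesP[hu [s [us s0 eu]]] := component_decomposes u.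
have /decomposesP[hv [t [ut t0 ev]]] := component_decomposes v.
rewrite (@component_unique _ (fun i => c *: comp i u + comp i v)) //.
apply/decomposesP; split=> [k|]; first by apply: (hdeg.1 k).2.
exists (undup (s ++ t)); rewrite undup_uniq; split=> // [k|].
  rewrite mem_undup mem_cat negb_or => /andP[/s0-> /t0->].
  by rewrite scaler0 addr0.
rewrite big_split -scaler_sumr; congr (_ *: _ + _).
  rewrite [LHS]eu; apply: sum_widen => //; first exact: undup_uniq.
  by move=> k hk; rewrite mem_undup mem_cat hk.
rewrite [LHS]ev; apply: sum_widen => //; first exact: undup_uniq.
by move=> k hk; rewrite mem_undup mem_cat hk orbT.
Qed.

Lemma component_sum v (s : seq I) : uniq s ->
  (forall i, i \notin s -> comp i v = 0) -> v = \sum_(i <- s) comp i v.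
Proof.
move=> us s0.
have /decomposesP[_ [t [ut t0 {1}->]]] := component_decomposes v.
rewrite (sum_widen (s' := undup (s ++ t))) ?undup_uniq //; last first.
  by move=> k hk; rewrite mem_undup mem_cat hk orbT.
rewrite -(sum_widen (s := s)) ?undup_uniq //.
by move=> k hk; rewrite mem_undup mem_cat hk.
Qed.

End Gradings.
(** * Lefschetz decomposition *)
Section Lefschetz.
Context {R : realType}.
Local Notation C := R[i].
Context {Om : algType C} {deg : nat -> set Om} {d star : Om -> Om}.
Context {bideg : nat -> nat -> set Om} {n : nat} {sigma : Om}.
Hypothesis hdeg : direct_sum deg.
Hypothesis degM : forall k l w v, deg k w -> deg l v -> deg (k + l)%N (w * v).
Hypothesis degV : forall k w, (2 * n < k)%N -> deg k w -> w = 0.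
Hypothesis hherm : hermitian_structure deg d star bideg n sigma.

Local Notation comp := (component deg).
Local Notation bideg2 := (fun ab : nat * nat => bideg ab.1 ab.2).
Local Notation bicomp := (component bideg2).

Let hcs := hs_complex hherm.
Let hbi : direct_sum bideg2 := cs_grading hcs.

Lemma deg_sub k : is_subspace (deg k).
Proof. exact: hdeg.1. Qed.

Lemma bideg_sub a b : is_subspace (bideg a b).
Proof. exact: (hbi.1 (a, b)). Qed.

Lemma bideg_deg a b w : bideg a b w -> deg (a + b)%N w.
Proof.
move=> hw; rewrite (cs_sum hcs).
exists (fun a' => if a' == a then w else 0).
  move=> a' _; case: eqP => [->|_]; last exact: (bideg_sub _ _).1.
  by rewrite addKn.
rewrite (bigD1 (Ordinal (leq_addr b a : (a < (a + b).+1)%N))) //= eqxx.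
by rewrite big1 ?addr0 // => i; rewrite -val_eqE /= => /negPf->.
Qed.

Lemma iter_lefschetz k w : iter k (lefschetz sigma) w = sigma ^+ k * w.
Proof. by elim: k => [|k IH]; rewrite ?mul1r //= IH /lefschetz exprS mulrA. Qed.

Lemma bideg_sigma a b k w : bideg a b w -> bideg (a + k) (b + k) (sigma ^+ k * w).
Proof.
move=> hw; elim: k => [|k IH]; first by rewrite mul1r !addn0.
by rewrite exprS -mulrA !addnS -[(_ + k).+1]add1n -[(b + k).+1]add1n;
  apply: (cs_mul hcs) => //; apply: (hs_bideg hherm).
Qed.

Lemma deg_sigma m k w : deg m w -> deg (m + 2 * k) (sigma ^+ k * w).
Proof.
move=> hw; elim: k => [|k IH]; first by rewrite mul1r muln0 addn0.
rewrite exprS -mulrA mulnS addnCA; apply: degM => //.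
exact: (bideg_deg (hs_bideg hherm)).
Qed.

Lemma sigma_comm k w : sigma ^+ k * w = w * sigma ^+ k.
Proof.
elim: k => [|k IH]; first by rewrite mul1r mulr1.
by rewrite exprS -mulrA IH mulrA (hs_central hherm) -mulrA.
Qed.

Lemma sigma_scale k (c : C) w : sigma ^+ k * (c *: w) = c *: (sigma ^+ k * w).
Proof. by rewrite -scalerAr. Qed.

Lemma lefschetz_inj k w :
  (k <= n)%N -> deg k w -> sigma ^+ (n - k) * w = 0 -> w = 0.
Proof.
rewrite leq_eqVlt => /orP[/eqP->|kn] hw; first by rewrite subnn mul1r.
have [_ inj _] := hs_lefschetz hherm kn; rewrite -iter_lefschetz => h0.
have d0 := (deg_sub k).1.
by apply: inj; rewrite ?in_setE // h0 iter_lefschetz mulr0.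
Qed.

Lemma lefschetz_surj k y : (k <= n)%N -> deg (2 * n - k) y ->
  exists2 x, deg k x & sigma ^+ (n - k) * x = y.
Proof.
rewrite leq_eqVlt => /orP[/eqP->|kn] hy.
  by exists y; rewrite ?subnn ?mul1r //; move: hy; rewrite mul2n -addnn addnK.
have [_ _ surj] := hs_lefschetz hherm kn.
by have [x hx <-] := surj _ hy; exists x; rewrite ?iter_lefschetz.
Qed.

(** A linear left inverse of L^(n - k) on degree k, defined on all forms by
    projecting to degree 2n - k first; being linear on the whole space it can
    be applied to one leg of a tensor. *)
Definition lef_inv k (y : Om) : Om :=
  xget 0 [set x | deg k x /\ sigma ^+ (n - k) * x = comp (2 * n - k)%N y].

Lemma lef_invP k y : (k <= n)%N ->
  deg k (lef_inv k y) /\ sigma ^+ (n - k) * lef_inv k y = comp (2 * n - k)%N y.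
Proof.
move=> kn; have [x hx e] := lefschetz_surj kn (component_deg hdeg _ y).
pose Q := [set x | deg k x /\ sigma ^+ (n - k) * x = comp (2 * n - k)%N y]%classic.
by apply: (@xgetPex _ 0 Q); exists x.
Qed.

Lemma lef_inv_unique k x y : (k <= n)%N -> deg k x ->
  sigma ^+ (n - k) * x = comp (2 * n - k)%N y -> lef_inv k y = x.
Proof.
move=> kn hx e; have [h1 h2] := lef_invP y kn.
apply/eqP; rewrite -subr_eq0; apply/eqP; apply: (lefschetz_inj kn).
  exact: (subspaceB (deg_sub k)).
by rewrite mulrBr h2 e subrr.
Qed.

Lemma lef_inv_linear k : (k <= n)%N -> linear (lef_inv k).
Proof.
move=> kn c x y; have [hx ex] := lef_invP x kn; have [hy ey] := lef_invP y kn.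
apply: lef_inv_unique => //; first exact: (deg_sub k).2.
by rewrite mulrDr sigma_scale ex ey (component_linear hdeg).
Qed.

Lemma lef_invK k x : (k <= n)%N -> deg k x -> lef_inv k (sigma ^+ (n - k) * x) = x.
Proof.
move=> kn hx; apply: lef_inv_unique => //.
rewrite (component_id hdeg) //.
by have := deg_sigma (n - k) hx; congr deg; lia.
Qed.

Definition primitive_deg k : set Om :=
  [set w | deg k w /\ sigma ^+ (n - k).+1 * w = 0].

(** For w of degree k, L^(n-k+1) w has degree 2n - (k-2), so it is L^(n-(k-2))
    of a unique form of degree k - 2, which [lower k] recovers from it; for
    k < 2 it is zero, having degree above 2n.  Subtracting L of the recovered
    form makes w primitive. *)
Definition lower k y := if (1 < k)%N then lef_inv (k - 2) y else 0.

Definition primitive_part k w := w - sigma * lower k (sigma ^+ (n - k).+1 * w).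

Lemma lower_linear k : (k <= n)%N -> linear (lower k).
Proof.
move=> kn c x y; rewrite /lower; case: ltnP => _.
  by rewrite lef_inv_linear //; lia.
by rewrite scaler0 addr0.
Qed.

Lemma lower_deg k y : (k.+2 <= n)%N -> deg k (lower k.+2 y).
Proof.
by move=> kn; rewrite /lower /= subn2 /=; have [] := @lef_invP k y (ltnW (ltnW kn)).
Qed.

Lemma lower_sigma k x : (k.+2 <= n)%N -> deg k x ->
  lower k.+2 (sigma ^+ (n - k.+2).+1 * (sigma * x)) = x.
Proof.
move=> kn hx; rewrite /lower /= subn2 /= mulrA -exprSr.
have -> : (n - k.+2).+2 = (n - k)%N by lia.
by rewrite lef_invK //; lia.
Qed.

Lemma primitive_part_linear k : (k <= n)%N -> linear (primitive_part k).
Proof.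
move=> kn c x y; rewrite /primitive_part mulrDr sigma_scale lower_linear //.
by rewrite mulrDr -scalerAr opprD scalerBr addrACA.
Qed.

Lemma primitive_part_primitive k w : (k <= n)%N -> deg k w ->
  primitive_deg k (primitive_part k w).
Proof.
move=> kn hw; split.
  apply: (subspaceB (deg_sub k)) => //.
  case: k kn {hw} => [|[|k]] kn; try by rewrite mulr0; apply: (deg_sub _).1.
  have := deg_sigma 1 (lower_deg (sigma ^+ (n - k.+2).+1 * w) kn).
  by rewrite expr1 muln1 addn2.
rewrite /primitive_part mulrBr; apply/eqP; rewrite subr_eq0; apply/eqP.
case: k kn hw => [|[|k]] kn hw; rewrite ?mulr0.
- by apply: degV (deg_sigma _ hw); lia.
- by apply: degV (deg_sigma _ hw); lia.
rewrite /lower /= mulrA -exprSr.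
have -> : (n - k.+2).+2 = (n - (k.+2 - 2))%N by lia.
have [|_ ->] := @lef_invP (k.+2 - 2) (sigma ^+ (n - k.+2).+1 * w); first by lia.
rewrite (component_id hdeg) //.
by have := deg_sigma (n - k.+2).+1 hw; congr deg; lia.
Qed.


Lemma bicomp_sum k w : deg k w ->
  w = \sum_(a < k.+1) bicomp (a : nat, (k - a)%N) w.
Proof.
rewrite (cs_sum hcs) => -[f hf ->]; apply: eq_bigr => a _.
have ak : (a <= k)%N by rewrite -ltnS.
rewrite (linear_bigsum (component_linear hbi _)) (bigD1 a) //= (component_id hbi) //=.
  rewrite big1 ?addr0 // => i ne.
  apply: (component_other hbi (i := (i : nat, (k - i)%N))) => /=.
    by apply: hf; rewrite -ltnS.
  by apply: contraNneq ne => -[e _]; rewrite -val_eqE /= e.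
exact: hf.
Qed.

(** Homogeneous components commute with powers of L, so the bihomogeneous
    components of a primitive form are primitive. *)
Lemma bicomp_sigma k m a b w : deg k w -> (a + b)%N = k ->
  sigma ^+ m * bicomp (a, b) w = bicomp ((a + m)%N, (b + m)%N) (sigma ^+ m * w).
Proof.
move=> hw hk; rewrite [in RHS](bicomp_sum hw) mulr_sumr.
have ak : (a < k.+1)%N by lia.
rewrite (linear_bigsum (component_linear hbi _)) (bigD1 (Ordinal ak)) //=.
have -> : (k - a)%N = b by lia.
rewrite (component_id hbi (i := ((a + m)%N, (b + m)%N))) /=.
  rewrite big1 ?addr0 // => i ne.
  apply: (component_other hbi (i := ((i + m)%N, (k - i + m)%N))) => /=.
    exact/bideg_sigma/(component_deg hbi (i : nat, (k - i)%N)).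
  apply: contraNneq ne => -[e _]; rewrite -val_eqE /=; apply/eqP; lia.
exact/bideg_sigma/(component_deg hbi (a, b)).
Qed.

Lemma primitive_bicomp a b w : (a + b <= n)%N -> primitive_deg (a + b) w ->
  primitive bideg n sigma a b (bicomp (a, b) w).
Proof.
move=> hn [hw h0]; split=> //; first exact: (component_deg hbi (a, b)).
by rewrite iter_lefschetz (bicomp_sigma _ hw) // h0 (linear_zero (component_linear hbi _)).
Qed.

Lemma primitive_primitive_deg a b w :
  primitive bideg n sigma a b w -> primitive_deg (a + b) w.
Proof. by case=> hn hw; rewrite iter_lefschetz => h0; split=> //; apply: bideg_deg. Qed.

(** The Lefschetz decomposition as an induction principle.  For degrees k <= n
    the claim is strengthened to all L^m w with m <= n - k, since the summand
    L w' of w that is left after removing the primitive part has w' of degree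
    k - 2; degrees above n are reached by L^(k-n). *)
Lemma lefschetz_ind (Q : nat -> Om -> Prop) :
  (forall k, Q k 0) -> (forall k x y, Q k x -> Q k y -> Q k (x + y)) ->
  (forall a b l w, primitive bideg n sigma a b w -> (l <= n - (a + b))%N ->
    Q (a + b + 2 * l)%N (sigma ^+ l * w)) ->
  forall k w, deg k w -> Q k w.
Proof.
move=> Q0 QD Qp.
have low k : (k <= n)%N -> forall w, deg k w ->
    forall m, (m <= n - k)%N -> Q (k + 2 * m)%N (sigma ^+ m * w).
  elim/ltn_ind: k => k IH kn w hw m hm.
  rewrite -[w](subrK (sigma * lower k (sigma ^+ (n - k).+1 * w))) mulrDr.
  apply: (QD).
    rewrite -/(primitive_part k w).
    have hp := primitive_part_primitive kn hw.
    rewrite [primitive_part k w](bicomp_sum hp.1) mulr_sumr.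
    elim/big_ind: _ => // [x y|a _]; first exact: (QD).
    have ak : (a + (k - a))%N = k by rewrite subnKC // -ltnS.
    rewrite -[in X in Q X _]ak; apply: (Qp); last by rewrite ak.
    by apply: primitive_bicomp; rewrite ak.
  case: k IH kn hw hm => [|[|k]] IH kn hw hm; rewrite ?mulr0 //.
  rewrite mulrA -exprSr.
  have -> : (k.+2 + 2 * m)%N = (k + 2 * m.+1)%N by lia.
  by apply: IH; [lia|lia|apply: lower_deg|lia].
move=> k w hw; have [kn|nk] := leqP k n.
  by have := low k kn w hw 0 (leq0n _); rewrite mul1r muln0 addn0.
have [k2|k2] := ltnP (2 * n) k; first by rewrite (degV k2 hw).
have [||x hx <-] := @lefschetz_surj (2 * n - k) w; first by lia.
  by rewrite subKn.
rewrite [X in Q X](_ : k = (2 * n - k) + 2 * (n - (2 * n - k)))%N; last by lia.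
by apply: (low) => //; lia.
Qed.

(** * The Hodge map *)

(** The part of the Hodge coefficient that depends on the total degree of the
    primitive form only; the power of the imaginary unit is put in
    [weil]. *)
Definition degree_coef (k l : nat) : C :=
  (-1) ^+ ((k * k.+1) %/ 2)%N * (l`!%:R / ((n - l - k)`!)%:R).

(** The value of the Hodge map, without its power of the imaginary unit, on
    L^l w for w of degree k <= n, computed by peeling off the primitive parts
    of w.  A recursion along linear maps needs no uniqueness of the
    decomposition. *)
Fixpoint hodge_low (k l : nat) (w : Om) : Om :=
  degree_coef k l *: (sigma ^+ (n - l - k) * primitive_part k w) +
  (if k is k'.+2 then hodge_low k' l.+1 (lower k (sigma ^+ (n - k).+1 * w))
   else 0).

Lemma hodge_low_linear k l : (k <= n)%N -> linear (hodge_low k l).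
Proof.
elim/ltn_ind: k l => k IH l kn c x y.
have e : degree_coef k l *: (sigma ^+ (n - l - k) * primitive_part k (c *: x + y)) =
    c *: (degree_coef k l *: (sigma ^+ (n - l - k) * primitive_part k x)) +
    degree_coef k l *: (sigma ^+ (n - l - k) * primitive_part k y).
  rewrite primitive_part_linear // mulrDr sigma_scale scalerDr !scalerA.
  by rewrite [c * _]mulrC.
case: k IH kn e => [|[|k]] IH kn e /=; rewrite e ?addr0 //.
rewrite [_ * (c *: x + y)]mulrDr sigma_scale lower_linear // IH //; last by lia.
by rewrite scalerDr addrACA.
Qed.

Lemma hodge_low_sigma i k l w : primitive_deg k w -> (k + 2 * i <= n)%N ->
  hodge_low (k + 2 * i) l (sigma ^+ i * w)
  = degree_coef k (l + i) *: (sigma ^+ (n - (l + i) - k) * w).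
Proof.
move=> hp; elim: i l => [|i IH] l hn.
  rewrite mul1r muln0 !addn0; rewrite muln0 addn0 in hn.
  have e : primitive_part k w = w.
    by rewrite /primitive_part hp.2 (linear_zero (lower_linear hn)) mulr0 subr0.
  have hl0 m m' : (m <= n)%N -> hodge_low m m' 0 = 0.
    by move=> hm; apply: linear_zero (hodge_low_linear _ hm).
  case: k hp hn e => [|[|k]] hp hn /= ->; rewrite ?addr0 //.
  by rewrite hp.2 (linear_zero (lower_linear hn)) hl0 ?addr0 //; lia.
have kE : (k + 2 * i.+1)%N = (k + 2 * i).+2 by lia.
rewrite kE in hn *; rewrite exprS -mulrA /=.
have hd := deg_sigma i hp.1.
rewrite /primitive_part lower_sigma // subrr mulr0 scaler0 add0r IH; last by lia.
by rewrite addSnnS.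
Qed.

(** The first sum treats the degrees up to n, the second one the degree 2n - k
    for k < n, which is L^(n-k) of degree k. *)
Definition hodge_deg (w : Om) : Om :=
  \sum_(k < n.+1) hodge_low k 0 (comp k w) +
  \sum_(k < n) hodge_low k (n - k) (lef_inv k w).

Lemma hodge_deg_linear : linear hodge_deg.
Proof.
move=> c x y; rewrite /hodge_deg scalerDr !scaler_sumr addrACA -!big_split.
congr (_ + _); apply: eq_bigr => k _.
  rewrite (component_linear hdeg) hodge_low_linear //.
  by rewrite -ltnS.
by rewrite lef_inv_linear ?hodge_low_linear // ltnW.
Qed.

Lemma hodge_deg_sigma k l w : primitive_deg k w -> (k <= n)%N ->
  (l <= n - k)%N ->
  hodge_deg (sigma ^+ l * w) = degree_coef k l *: (sigma ^+ (n - l - k) * w).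
Proof.
move=> hp kn ln; have hd := deg_sigma l hp.1.
have hl0 m m' : (m <= n)%N -> hodge_low m m' 0 = 0.
  by move=> hm; apply: linear_zero (hodge_low_linear _ hm).
rewrite /hodge_deg; have [hn|hn] := leqP (k + 2 * l) n.
  have hn' : (k + 2 * l < n.+1)%N by [].
  rewrite (bigD1 (Ordinal hn')) //= (component_id hdeg) // hodge_low_sigma //.
  rewrite add0n big1 ?addr0 => [|i ne]; last first.
    by rewrite (component_other hdeg hd) ?hl0 // -ltnS.
  rewrite big1 ?addr0 // => i _.
  rewrite (@lef_inv_unique i 0) ?hl0 //; [exact: ltnW|exact: ltnW|exact: (deg_sub _).1|].
  by rewrite mulr0 (component_other hdeg hd) //; apply/eqP; have := ltn_ord i; lia.
rewrite big1 ?add0r => [|i _]; last first.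
  rewrite (component_other hdeg hd) ?hl0 //; first by rewrite -ltnS.
  by apply/eqP; have := ltn_ord i; lia.
have ki : (2 * n - (k + 2 * l) < n)%N by lia.
rewrite (bigD1 (Ordinal ki)) //= [X in _ + X]big1 ?addr0 => [|i ne]; last first.
  rewrite (@lef_inv_unique i 0) ?hl0 //; [exact: ltnW|exact: ltnW|exact: (deg_sub _).1|].
  rewrite mulr0 (component_other hdeg hd) //; apply: contraNneq ne => e.
  by rewrite -val_eqE /=; apply/eqP; have := ltn_ord i; lia.
rewrite (@lef_inv_unique _ (sigma ^+ (n - k - l) * w)); first last.
- rewrite mulrA -exprD (_ : (_ + _)%N = l); last by lia.
  by rewrite (component_id hdeg) //; move: hd; congr deg; lia.
- by have := deg_sigma (n - k - l) hp.1; congr deg; lia.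
- by lia.
have -> : (2 * n - (k + 2 * l))%N = (k + 2 * (n - k - l))%N by lia.
rewrite hodge_low_sigma //; last by lia.
by have -> : (n - (k + 2 * (n - k - l)) + (n - k - l))%N = l by lia.
Qed.

Definition bidegrees : seq (nat * nat) :=
  [seq (a, b) | a <- iota 0 (2 * n).+1, b <- iota 0 (2 * n).+1].

Lemma bidegrees_uniq : uniq bidegrees.
Proof.
apply: (@allpairs_uniq _ _ _ (fun a b => (a, b))); try exact: iota_uniq.
by move=> [? ?] [? ?] _ _ [-> ->].
Qed.

(** The Weil operator.  It commutes with L, which does not change a - b. *)
Definition weil (w : Om) : Om :=
  \sum_(p <- bidegrees) ('i%C ^ (p.1%:Z - p.2%:Z) : C) *: bicomp p w.

Lemma weil_linear : linear weil.
Proof.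
move=> c x y; rewrite /weil scaler_sumr -big_split; apply: eq_bigr => p _.
by rewrite (component_linear hbi) scalerDr !scalerA [c * _]mulrC.
Qed.

Lemma weil_bideg a b w : bideg a b w -> weil w = ('i%C ^ (a%:Z - b%:Z) : C) *: w.
Proof.
move=> hw; have [ab|ab] := ltnP (2 * n) (a + b).
  by rewrite (degV ab (bideg_deg hw)) scaler0 (linear_zero weil_linear).
rewrite /weil (bigD1_seq (a, b)) ?bidegrees_uniq //; last first.
  by apply: allpairs_f; rewrite mem_iota; lia.
rewrite /= (component_id hbi (i := (a, b))) // big1 ?addr0 // => p ne.
by rewrite (component_other hbi (i := (a, b))) ?scaler0.
Qed.

Lemma hodge_exists : exists H, is_hodge bideg n sigma H.
Proof.
exists (hodge_deg \o weil); split.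
  by move=> c x y /=; rewrite weil_linear hodge_deg_linear.
move=> a b l w hw hl; rewrite !iter_lefschetz /=.
have [hn hab _] := hw; have hp := primitive_primitive_deg hw.
rewrite (weil_bideg (bideg_sigma l hab)) (linear_scale hodge_deg_linear).
rewrite (hodge_deg_sigma hp hn hl) scalerA; congr (_ *: _).
rewrite /degree_coef /hodge_coef !mulrA; congr (_ * _ * _).
rewrite mulrC; congr (_ * 'i%C ^ _).
by rewrite !PoszD opprD addrACA subrr addr0.
Qed.

Lemma hodge_unique H H' w : is_hodge bideg n sigma H ->
  is_hodge bideg n sigma H' -> (exists k, deg k w) -> H w = H' w.
Proof.
move=> [hl hv] [hl' hv'] [k hw].
apply: (lefschetz_ind (Q := fun _ w => H w = H' w)) hw => [_|_ x y|a b l w' hw hln].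
- by rewrite (linear_zero hl) (linear_zero hl').
- by rewrite (linear_add hl) (linear_add hl') => -> ->.
- by rewrite -iter_lefschetz (hv _ _ _ _ hw hln) (hv' _ _ _ _ hw hln).
Qed.

Local Notation hodge := (hodge bideg n sigma).

Lemma comp_ge k w : (2 * n < k)%N -> comp k w = 0.
Proof. by move=> hk; apply: degV hk _; apply: component_deg. Qed.

Lemma comp_sum w : w = \sum_(k < (2 * n).+1) comp k w.
Proof.
rewrite -(big_mkord predT (fun k => comp k w)) /index_iota subn0.
apply: (component_sum hdeg) => [|]; first exact: iota_uniq.
by move=> k; rewrite mem_iota => hk; apply: comp_ge; lia.
Qed.

Lemma hodgeE H : is_hodge bideg n sigma H -> hodge = H.
Proof.
move=> hH; apply/funext => w; apply: xget_unique; first by exists H.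
move=> y [H' hH' ->]; rewrite [w]comp_sum.
rewrite (linear_bigsum hH.1) (linear_bigsum hH'.1); apply: eq_bigr => k _.
by apply: hodge_unique => //; exists k; apply: component_deg.
Qed.

Lemma hodge_is_hodge : is_hodge bideg n sigma hodge.
Proof. by have [H hH] := hodge_exists; rewrite (hodgeE hH). Qed.

Lemma hodge_linear : linear hodge.
Proof. exact: hodge_is_hodge.1. Qed.

Lemma hodge_sigma a b l w : primitive bideg n sigma a b w ->
  (l <= n - (a + b))%N ->
  hodge (sigma ^+ l * w)
  = hodge_coef n a b l *: (sigma ^+ (n - l - (a + b)) * w).
Proof. by move=> hw hl; have := hodge_is_hodge.2 a b l w hw hl; rewrite !iter_lefschetz. Qed.

Lemma hodge_degree k w : (k <= 2 * n)%N -> deg k w -> deg (2 * n - k)%N (hodge w).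
Proof.
move=> kn hw; move: k w hw kn.
apply: lefschetz_ind => [k|k x y hx hy kn|a b l w hw hl kn].
- by rewrite (linear_zero hodge_linear) => _; apply: (deg_sub _).1.
- by rewrite (linear_add hodge_linear); apply: (subspaceD (deg_sub _)); auto.
- rewrite (hodge_sigma hw hl); apply: (subspaceZ (deg_sub _)).
  have [hab /bideg_deg hd _] := hw.
  by have := deg_sigma (n - l - (a + b)) hd; congr deg; lia.
Qed.

Lemma primitive_mull b0 a b w : bideg 0 0 b0 ->
  primitive bideg n sigma a b w -> primitive bideg n sigma a b (b0 * w).
Proof.
move=> hb [hn hw h0]; split=> //; first by have := cs_mul hcs hb hw.
move: h0; rewrite !iter_lefschetz => h0.
by rewrite mulrA sigma_comm -mulrA h0 mulr0.
Qed.

Lemma primitive_mulr b0 a b w : bideg 0 0 b0 ->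
  primitive bideg n sigma a b w -> primitive bideg n sigma a b (w * b0).
Proof.
move=> hb [hn hw h0]; split=> //.
  by have := cs_mul hcs hw hb; rewrite !addn0.
by move: h0; rewrite !iter_lefschetz mulrA => ->; rewrite mul0r.
Qed.

Lemma hodge_mull b0 k w : bideg 0 0 b0 -> deg k w -> hodge (b0 * w) = b0 * hodge w.
Proof.
move=> hb; apply: (lefschetz_ind (Q := fun _ w => hodge (b0 * w) = b0 * hodge w)).
- by move=> _; rewrite mulr0 (linear_zero hodge_linear) mulr0.
- by move=> _ x y hx hy; rewrite mulrDr !(linear_add hodge_linear) hx hy mulrDr.
- move=> a b l {}w hw hl; rewrite mulrA -sigma_comm -mulrA.
  rewrite (hodge_sigma hw hl) (hodge_sigma (primitive_mull hb hw) hl).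
  by rewrite -scalerAr !mulrA sigma_comm.
Qed.

Lemma hodge_mulr b0 k w : bideg 0 0 b0 -> deg k w -> hodge (w * b0) = hodge w * b0.
Proof.
move=> hb; apply: (lefschetz_ind (Q := fun _ w => hodge (w * b0) = hodge w * b0)).
- by move=> _; rewrite mul0r (linear_zero hodge_linear) mul0r.
- by move=> _ x y hx hy; rewrite mulrDl !(linear_add hodge_linear) hx hy mulrDl.
- move=> a b l {}w hw hl; rewrite -mulrA (hodge_sigma hw hl).
  rewrite (hodge_sigma (primitive_mulr hb hw) hl).
  by rewrite -scalerAl mulrA.
Qed.

(** Top degree is L^n of degree 0, hence of bidegree (n, n). *)
Lemma bideg_top p q w : deg (2 * n)%N w -> bideg p q w -> p != q -> w = 0.
Proof.
move=> hw hpq ne.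
have := @lefschetz_surj 0 w; rewrite !subn0 => /(_ isT hw)[x hx e].
have h00 : bideg 0 0 x.
  move: hx; rewrite (cs_sum hcs) => -[f hf ->].
  by rewrite big_ord1; have := hf 0%N (leqnn _).
have := bideg_sigma n h00; rewrite e => hnn.
rewrite -(component_id hbi (i := (p, q)) hpq).
apply: (component_other hbi (i := (0 + n, 0 + n)%N)) => //.
by apply: contraNneq ne => -[-> ->].
Qed.

Lemma invr_i : ('i%C : C)^-1 = - 'i%C.
Proof.
have i2 : ('i%C : C) ^+ 2 = -1 by apply: sqr_i.
have i0 : ('i%C : C) != 0.
  by apply/eqP => i0; move/eqP: i2; rewrite i0 expr0n /= eq_sym oppr_eq0 oner_eq0.
by apply: (mulfI i0); rewrite divff // mulrN -expr2 i2 opprK.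
Qed.

(** The power b - a of the imaginary unit differs from the power a - b by the
    sign (-1)^(a-b) = (-1)^(a+b). *)
Lemma hodge_coef_swap a b l :
  hodge_coef n b a l = (-1) ^+ (a + b) * (hodge_coef n a b l : C).
Proof.
rewrite /hodge_coef [(b + a)%N]addnC.
have -> : ('i%C ^ (b%:Z - a%:Z) : C) = (-1) ^+ (a + b) * 'i%C ^ (a%:Z - b%:Z).
  rewrite -opprB -exprz_inv invr_i expNrz expN1r; congr (_ * _).
  by rewrite -signr_odd -[in RHS]signr_odd; congr ((-1) ^+ nat_of_bool _); lia.
by rewrite -!mulrA mulrCA.
Qed.

Lemma sigma_primitive_mul a b e w v : primitive bideg n sigma a b w ->
  (n - (a + b) < e)%N -> sigma ^+ e * (w * v) = 0.
Proof.
move=> [_ _]; rewrite iter_lefschetz => h0 he.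
by rewrite -(subnK he) exprD -mulrA [_ ^+ _ * (w * v)]mulrA h0 mul0r mulr0.
Qed.

(** Both sides are multiples of a power of sigma times w v.  If i and m differ
    the power is large enough to kill the primitive factor of higher degree;
    if i = m, a nonzero product lies in bidegree (n, n), which forces
    (a', b') = (b, a). *)
Lemma hodge_wedge_primitive a b a' b' i m w v :
  primitive bideg n sigma a b w -> primitive bideg n sigma a' b' v ->
  (i <= n - (a + b))%N -> (m <= n - (a' + b'))%N ->
  (a + b + 2 * i = a' + b' + 2 * m)%N ->
  sigma ^+ i * w * hodge (sigma ^+ m * v)
  = (-1) ^+ (a + b) *: (hodge (sigma ^+ i * w) * (sigma ^+ m * v)).
Proof.
move=> hw hv hi hm hk; have [hn hw' _] := hw; have [hn' hv' _] := hv.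
rewrite (hodge_sigma hw hi) (hodge_sigma hv hm).
rewrite -scalerAr -scalerAl scalerA.
have e1 s t (x y : Om) : sigma ^+ s * x * (sigma ^+ t * y) = sigma ^+ (s + t) * (x * y).
  by rewrite -mulrA [x * _]mulrA -(sigma_comm t x) exprD !mulrA.
rewrite !e1; have [lt|gt|eq] := ltngtP i m.
- by rewrite !(sigma_primitive_mul _ hw) ?scaler0 //; lia.
- have e2 s : (n - (a' + b') < s)%N -> sigma ^+ s * (w * v) = 0.
    move=> hs; rewrite mulrA (sigma_comm s w) -mulrA.
    by have := sigma_primitive_mul 1 hv hs; rewrite mulr1 => ->; rewrite mulr0.
  by rewrite !e2 ?scaler0 //; lia.
subst m; have hab : (a' + b' = a + b)%N by lia.
have -> : (i + (n - i - (a' + b')) = n - (a + b))%N by lia.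
have -> : (n - i - (a + b) + i = n - (a + b))%N by lia.
have [ha|ne] := eqVneq (a + a')%N (b + b')%N.
  have a'E : a' = b. by lia.
  have b'E : b' = a by lia.
  rewrite a'E b'E.
  by rewrite hodge_coef_swap.
have hb := bideg_sigma (n - (a + b)) (cs_mul hcs hw' hv').
rewrite (bideg_top _ hb) ?scaler0 //.
  by have := bideg_deg hb; congr deg; lia.
by rewrite eqn_add2r.
Qed.

Lemma hodge_wedge k f z : deg k f -> deg k z ->
  f * hodge z = (-1) ^+ k *: (hodge f * z).
Proof.
move=> hf; move: z.
apply: (lefschetz_ind (Q := fun k f => forall z, deg k z ->
  f * hodge z = (-1) ^+ k *: (hodge f * z))) hf => [{}k z _|{}k x y hx hy z hz|].
- by rewrite (linear_zero hodge_linear) !mul0r scaler0.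
- by rewrite (linear_add hodge_linear) !mulrDl scalerDr hx ?hy.
move=> a b i w hw hi z hz.
suff h K v : deg K v -> (a + b + 2 * i)%N = K -> sigma ^+ i * w * hodge v =
    (-1) ^+ (a + b + 2 * i) *: (hodge (sigma ^+ i * w) * v) by exact: h hz erefl.
move=> hv; apply: (lefschetz_ind (Q := fun K v => (a + b + 2 * i)%N = K ->
    sigma ^+ i * w * hodge v =
    (-1) ^+ (a + b + 2 * i) *: (hodge (sigma ^+ i * w) * v))) hv
  => [k' _|k' x y hx hy e|].
- by rewrite (linear_zero hodge_linear) !mulr0 scaler0.
- by rewrite (linear_add hodge_linear) !mulrDr scalerDr hx ?hy.
move=> a' b' m {}v hv hm e; rewrite (hodge_wedge_primitive hw hv hi hm e).
by rewrite [in RHS]exprD exprM sqrrN !expr1n mulr1.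
Qed.

(** * The pairing defined by the Hodge map *)
Hypothesis hstar : conj_involution star.
Hypothesis starM : forall k l w v, deg k w -> deg l v ->
  star (w * v) = (-1) ^+ (k * l)%N *: (star v * star w).

Lemma starD : {morph star : x y / x + y}.
Proof. by move=> x y; have := conj_inv_lin hstar 1 x y; rewrite rmorph1 !scale1r. Qed.

Lemma star0 : star 0 = 0.
Proof. by apply: (addrI (star 0)); rewrite -starD !addr0. Qed.

Lemma starZ (c : C) x : star (c *: x) = (c^*)%C *: star x.
Proof. by have := conj_inv_lin hstar c x 0; rewrite star0 !addr0. Qed.

Lemma bideg_star a b w : bideg a b w -> bideg b a (star w).
Proof. by move=> hw; rewrite -(cs_star hcs); exists w. Qed.

Lemma deg_star k w : deg k w -> deg k (star w).
Proof.
rewrite {1}(cs_sum hcs) => -[f hf ->]; rewrite (big_morph _ starD star0).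
apply: (subspace_sum (deg_sub k)) => a _.
have ak : (a <= k)%N by rewrite -ltnS.
by have := bideg_deg (bideg_star (hf a ak)); congr deg; lia.
Qed.

Lemma star_sigma k l w : deg l w -> star (sigma ^+ k * w) = sigma ^+ k * star w.
Proof.
move=> hw; elim: k => [|k IH]; first by rewrite !mul1r.
rewrite exprS -mulrA (starM (bideg_deg (hs_bideg hherm)) (deg_sigma k hw)).
by rewrite exprM sqrrN !expr1n scale1r IH (hs_real hherm) -(hs_central hherm) mulrA.
Qed.

Lemma primitive_star a b w : primitive bideg n sigma a b w ->
  primitive bideg n sigma b a (star w).
Proof.
move=> [hn hw]; rewrite iter_lefschetz => h0; split; rewrite ?[(b + a)%N]addnC //.
  exact: bideg_star.
by rewrite iter_lefschetz -(star_sigma _ (bideg_deg hw)) h0 star0.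
Qed.

Lemma conjc_i : ('i%C : C)^*%C = - 'i%C.
Proof. by rewrite -[LHS]/(Complex 0 (-1)) -[RHS]/(Complex (- 0) (-1)) oppr0. Qed.

Lemma conjc_i_exprz (m : int) : (('i%C : C) ^ m)^*%C = (- 'i%C : C) ^ m.
Proof.
have conj_exprz (f : {rmorphism C -> C}) :
    f 'i%C = - 'i%C -> f ('i%C ^ m) = (- 'i%C) ^ m.
  by move=> hf; rewrite fmorphXz hf.
exact: (conj_exprz (@conjc R) conjc_i).
Qed.

Lemma hodge_coef_conj a b l : ((hodge_coef n a b l : C)^*)%C = hodge_coef n b a l.
Proof.
rewrite /hodge_coef [(b + a)%N]addnC !rmorphM /= rmorph_sign fmorphV !rmorph_nat.
congr (_ * _ * _).
by rewrite -[b%:Z - a%:Z]opprB -exprz_inv invr_i; apply: conjc_i_exprz.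
Qed.

Lemma hodge_star k w : deg k w -> hodge (star w) = star (hodge w).
Proof.
apply: (lefschetz_ind (Q := fun _ w => hodge (star w) = star (hodge w))).
- by move=> _; rewrite star0 (linear_zero hodge_linear) star0.
- by move=> _ x y hx hy; rewrite starD !(linear_add hodge_linear) hx hy starD.
- move=> a b l {}w hw hl; have [_ /bideg_deg hd _] := hw.
  rewrite (star_sigma _ hd) (hodge_sigma hw hl).
  rewrite (hodge_sigma (primitive_star hw)); last by rewrite addnC.
  by rewrite starZ (star_sigma _ hd) hodge_coef_conj [(b + a)%N]addnC.
Qed.

Lemma comp_commute (g : Om -> Om) k w : {morph g : x y / x + y} ->
  (forall k w, deg k w -> deg k (g w)) -> comp k (g w) = g (comp k w).
Proof.
move=> gD gk; have g0 : g 0 = 0 by apply: (addrI (g 0)); rewrite -gD !addr0.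
rewrite [in LHS](comp_sum w) (big_morph g gD g0).
rewrite (linear_bigsum (component_linear hdeg k)).
have [kn|kn] := ltnP k (2 * n).+1.
  rewrite (bigD1 (Ordinal kn)) //= (component_id hdeg); last exact/gk/component_deg.
  rewrite big1 ?addr0 // => i ne.
  apply: (component_other hdeg (i := i)); first exact/gk/component_deg.
  by apply: contraNneq ne => e; rewrite -val_eqE /= e.
rewrite comp_ge // g0 big1 // => i _.
by rewrite comp_ge //; apply/component_deg.
Qed.

Lemma comp_star k w : comp k (star w) = star (comp k w).
Proof. by apply: comp_commute; [exact: starD | exact: deg_star]. Qed.

Definition pairing (f z : Om) : Om :=
  \sum_(k < (2 * n).+1) hodge (comp k f * hodge (comp k z)).

Lemma pairing_deg0 f z : deg 0%N (pairing f z).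
Proof.
apply: (subspace_sum (deg_sub 0)) => k _; have kn : (k <= 2 * n)%N by rewrite -ltnS.
have h1 := hodge_degree kn (component_deg hdeg k z).
have h2 := degM (component_deg hdeg k f) h1; rewrite subnKC // in h2.
by have := hodge_degree (leqnn _) h2; rewrite subnn.
Qed.

Lemma pairingDl f f' z : pairing (f + f') z = pairing f z + pairing f' z.
Proof.
rewrite -big_split; apply: eq_bigr => k _.
by rewrite (linear_add (component_linear hdeg k)) mulrDl (linear_add hodge_linear).
Qed.

Lemma pairingDr f z z' : pairing f (z + z') = pairing f z + pairing f z'.
Proof.
rewrite -big_split; apply: eq_bigr => k _.
rewrite (linear_add (component_linear hdeg k)) (linear_add hodge_linear).
by rewrite mulrDr (linear_add hodge_linear).
Qed.

Lemma deg0_bideg b0 : deg 0%N b0 -> bideg 0 0 b0.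
Proof.
rewrite (cs_sum hcs) => -[f hf ->].
by rewrite big_ord1; have := hf 0%N (leqnn _).
Qed.

Lemma comp_mull b0 k w : deg 0%N b0 -> comp k (b0 * w) = b0 * comp k w.
Proof.
move=> hb; apply: (comp_commute (g := fun w => b0 * w)); first exact: mulrDr.
by move=> l v hv; have := degM hb hv.
Qed.

Lemma comp_mulr b0 k w : deg 0%N b0 -> comp k (w * b0) = comp k w * b0.
Proof.
move=> hb; apply: (comp_commute (g := fun w => w * b0)).
  by move=> x y; rewrite mulrDl.
by move=> l v hv; have := degM hv hb; rewrite addn0.
Qed.

Lemma pairing_terms f z k : (k < (2 * n).+1)%N ->
  deg (2 * n)%N (comp k f * hodge (comp k z)).
Proof.
move=> kn; have h1 := hodge_degree (kn : (k <= _)%N) (component_deg hdeg k z).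
by have := degM (component_deg hdeg k f) h1; rewrite subnKC.
Qed.

Lemma pairing_mull b0 f z : deg 0%N b0 -> pairing (b0 * f) z = b0 * pairing f z.
Proof.
move=> hb; rewrite mulr_sumr; apply: eq_bigr => k _.
rewrite (comp_mull _ _ hb) -mulrA (hodge_mull (deg0_bideg hb) (pairing_terms f z _)) //.
Qed.

Lemma pairing_mulr b0 f z : deg 0%N b0 -> pairing f (z * b0) = pairing f z * b0.
Proof.
move=> hb; rewrite mulr_suml; apply: eq_bigr => k _.
rewrite (comp_mulr _ _ hb) (hodge_mulr (deg0_bideg hb) (component_deg hdeg k z)).
by rewrite mulrA (hodge_mulr (deg0_bideg hb) (pairing_terms f z _)).
Qed.

Lemma pairing_balanced b0 f z : deg 0%N b0 -> pairing (f * b0) z = pairing f (b0 * z).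
Proof.
move=> hb; apply: eq_bigr => k _; rewrite (comp_mulr _ _ hb) (comp_mull _ _ hb).
by rewrite (hodge_mull (deg0_bideg hb) (component_deg hdeg k z)) mulrA.
Qed.

Lemma odd_mul_complement k m : (k <= 2 * m)%N -> odd (k * (2 * m - k)) = odd k.
Proof. by move=> km; rewrite oddM oddB // mul2n odd_double; case: (odd k). Qed.

(** The sign (-1)^(k(2n-k)) = (-1)^k from reversing the product is the one of
    [hodge_wedge]. *)
Lemma pairing_star f z : pairing f z = star (pairing (star z) (star f)).
Proof.
rewrite (big_morph _ starD star0); apply: eq_bigr => k _.
have kn : (k <= 2 * n)%N by rewrite -ltnS.
rewrite -(hodge_star (pairing_terms _ _ _)) // !comp_star.
have hf := component_deg hdeg k f; have hz := component_deg hdeg k z.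
rewrite (hodge_star hf); congr (hodge _).
rewrite (starM (deg_star hz) (deg_star (hodge_degree kn hf))).
rewrite !(conj_inv_invol hstar) (hodge_wedge hf hz); congr (_ *: _).
by rewrite -[RHS]signr_odd odd_mul_complement // signr_odd.
Qed.

(** * Covariance of the pairing *)
Context {A : algType C} {rho : Om -> (A ⊗ Om)%type}.
Hypothesis rhoL : linear rho.
Hypothesis rhoM : forall w v, rho (w * v) = tmul (rho w) (rho v).
Hypothesis rho_bideg : covariant_complex_structure rho bideg.
Hypothesis rho_sigma : rho sigma = 1 ⊗ sigma.

Lemma tens_in_mono (Q Q' : set Om) (x : (A ⊗ Om)%type) :
  (forall w, Q w -> Q' w) -> tens_in Q x -> tens_in Q' x.
Proof. by move=> hQ [s hs ->]; exists s => // p /hs /hQ. Qed.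

Lemma tens_in_sum (Q : set Om) (I : Type) (r : seq I) (f : I -> (A ⊗ Om)%type) :
  (forall i, tens_in Q (f i)) -> tens_in Q (\sum_(i <- r) f i).
Proof.
move=> hf; elim/big_ind: _ => [|x y [s hs ->] [t ht ->]|i _]; last exact: hf.
  by exists [::]; rewrite ?big_nil.
exists (s ++ t); last by rewrite big_cat.
by move=> p; rewrite mem_cat => /orP[/hs|/ht].
Qed.

Lemma rho_sigma_exp k w :
  rho (sigma ^+ k * w) = tmap id (fun x => sigma ^+ k * x) (rho w).
Proof.
have [s hs] := tensor_sum (rho w).
have sl m : linear (fun x : Om => sigma ^+ m * x).
  by move=> c x y; rewrite mulrDr sigma_scale.
rewrite hs tmap_sum //; elim: k => [|k IH].
  by rewrite mul1r hs; apply: eq_bigr => p _; rewrite mul1r.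
rewrite exprS -mulrA rhoM rho_sigma IH.
rewrite -(big_seq1 +%R (1 : A, sigma) (fun p => p.1 ⊗ p.2)).
rewrite -(big_map (fun p : A * Om => (p.1, sigma ^+ k * p.2)) predT
  (fun p => p.1 ⊗ p.2)) tmul_sum big_seq1 big_map.
by apply: eq_bigr => p _; rewrite /= mul1r mulrA.
Qed.

Lemma rho_deg k w : deg k w -> tens_in (deg k) (rho w).
Proof.
move=> hw; rewrite (bicomp_sum hw) (linear_bigsum rhoL).
apply: tens_in_sum => a; have ak : (a <= k)%N by rewrite -ltnS.
apply: tens_in_mono (rho_bideg (component_deg hbi (a : nat, (k - a)%N) w)) => v hv.
by have := bideg_deg hv; rewrite /= subnKC.
Qed.

Lemma rho_comp k w : rho (comp k w) = tmap id (comp k) (rho w).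
Proof.
have cl := component_linear hdeg k.
rewrite [in RHS](comp_sum w) (linear_bigsum rhoL) (linear_bigsum (tmap_linear cl)).
have [kn|kn] := ltnP k (2 * n).+1; last first.
  rewrite comp_ge // (linear_zero rhoL) big1 // => i _.
  have [s hs ->] := rho_deg (component_deg hdeg i w).
  rewrite tmap_sum // big_seq big1 // => p /hs hp.
  by rewrite (component_other hdeg hp) ?tens0r //; apply/eqP; have := ltn_ord i; lia.
rewrite (bigD1 (Ordinal kn)) //= [X in _ = _ + X]big1 ?addr0 => [|i ne].
  have [s hs ->] := rho_deg (component_deg hdeg k w).
  rewrite tmap_sum // big_seq [RHS]big_seq; apply: eq_bigr => p /hs hp.
  by rewrite (component_id hdeg hp).
have [s hs ->] := rho_deg (component_deg hdeg i w).
rewrite tmap_sum // big_seq big1 // => p /hs hp.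
rewrite (component_other hdeg hp) ?tens0r //.
by apply: contraNneq ne => e; rewrite -val_eqE /= e.
Qed.

(** If w is primitive, the linear map [primitive_part] applied to the second
    legs of its coaction changes nothing, because it subtracts a linear image
    of rho (L^(n-k+1) w) = 0; after it the second legs are primitive.  This
    replaces a choice of linearly independent first legs. *)
Lemma rho_primitive a b w : primitive bideg n sigma a b w ->
  tens_in (primitive bideg n sigma a b) (rho w).
Proof.
move=> hw; have [hn hab _] := hw; have [hd h0] := primitive_primitive_deg hw.
have pl := primitive_part_linear hn; have bl := component_linear hbi (a, b).
have [s hs e] := rho_bideg hab.
have e1 : rho w = tmap id (primitive_part (a + b)) (rho w).
  pose g x := sigma * lower (a + b) x.
  have gl : linear g.
    by move=> c x y; rewrite /g (lower_linear hn) mulrDr -scalerAr.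
  have := congr1 (tmap id g) (rho_sigma_exp (n - (a + b)).+1 w).
  rewrite h0 (linear_zero rhoL) (linear_zero (tmap_linear gl)).
  have sl : linear (fun x : Om => sigma ^+ (n - (a + b)).+1 * x).
    by move=> c x y; rewrite mulrDr sigma_scale.
  rewrite e !tmap_sum // => h.
  have := tmap_sum gl [seq (p.1, sigma ^+ (n - (a + b)).+1 * p.2) | p <- s].
  rewrite !big_map /= -h => h'.
  rewrite -[LHS]subr0 [X in _ - X = _]h' -sumrB; apply: eq_bigr => p _.
  by rewrite -tensBr.
(* The primitive parts of the second legs need not be bihomogeneous, so they are
   projected to bidegree (a, b), where the legs already were. *)
have e2 : tmap id (bicomp (a, b)) (rho w) = rho w.
  rewrite e tmap_sum // big_seq [RHS]big_seq; apply: eq_bigr => p /hs hp.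
  by rewrite (component_id hbi (i := (a, b))).
exists [seq (p.1, bicomp (a, b) (primitive_part (a + b) p.2)) | p <- s].
  move=> q /mapP[p /hs hp ->] /=; apply: primitive_bicomp => //.
  exact: primitive_part_primitive (bideg_deg hp).
rewrite -e2 e1 [in LHS]e tmap_sum // big_map.
have := tmap_sum bl [seq (p.1, primitive_part (a + b) p.2) | p <- s].
by rewrite !big_map.
Qed.

Lemma rho_hodge k w : deg k w -> rho (hodge w) = tmap id hodge (rho w).
Proof.
have hl := hodge_linear; have tl := tmap_linear (V := A) hl.
apply: (lefschetz_ind (Q := fun _ w => rho (hodge w) = tmap id hodge (rho w))).
- by move=> _; rewrite (linear_zero hl) (linear_zero rhoL) (linear_zero tl).
- move=> _ x y hx hy; rewrite (linear_add hl) !(linear_add rhoL) hx hy.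
  by rewrite (linear_add tl).
move=> a b l {}w hw hln; rewrite (hodge_sigma hw hln) (linear_scale rhoL).
rewrite !rho_sigma_exp; have [s hs ->] := rho_primitive hw.
have sl m : linear (fun x : Om => sigma ^+ m * x).
  by move=> c x y; rewrite mulrDr sigma_scale.
rewrite !tmap_sum // scaler_sumr.
have := tmap_sum hl [seq (p.1, sigma ^+ l * p.2) | p <- s].
rewrite !big_map => ->; rewrite big_seq [RHS]big_seq.
apply: eq_bigr => p /hs hp /=; rewrite (hodge_sigma hp hln).
by rewrite tensZr.
Qed.

Lemma rho_pairing f z : rho (pairing f z) =
  tlift (fun a f0 => tlift (fun c z0 => (a * c) ⊗ pairing f0 z0) (rho z)) (rho f).
Proof.
have [s hs] := tensor_sum (rho f); have [t ht] := tensor_sum (rho z).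
have pl z' : linear (pairing^~ z').
  move=> c x y; rewrite pairingDl; congr (_ + _).
  rewrite scaler_sumr; apply: eq_bigr => k _.
  by rewrite (linear_scale (component_linear hdeg k)) -scalerAl (linear_scale hodge_linear).
have pr f' : linear (pairing f').
  move=> c x y; rewrite pairingDr; congr (_ + _).
  rewrite scaler_sumr; apply: eq_bigr => k _.
  rewrite (linear_scale (component_linear hdeg k)) (linear_scale hodge_linear).
  by rewrite -scalerAr (linear_scale hodge_linear).
have hb a f0 : cbalanced (fun (c : A) z0 => (a * c) ⊗ pairing f0 z0).
  apply: bilinear_balanced => [w|v] k x y.
    by rewrite mulrDr -scalerAr tensDl tensZl.
  by rewrite pr tensDr tensZr.
have hb' : cbalanced (fun (a : A) f0 =>
    tlift (fun c z0 => (a * c) ⊗ pairing f0 z0) (rho z)).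
  rewrite ht; apply: bilinear_balanced => [w|v] k x y; rewrite !tlift_sum //.
    rewrite scaler_sumr -big_split; apply: eq_bigr => p _ /=.
    by rewrite mulrDl -scalerAl tensDl tensZl.
  rewrite scaler_sumr -big_split; apply: eq_bigr => p _ /=.
  by rewrite pl tensDr tensZr.
rewrite hs tlift_sum //.
under eq_bigr do rewrite ht tlift_sum //.
rewrite (linear_bigsum rhoL).
transitivity (\sum_(k < (2 * n).+1) \sum_(p <- s) \sum_(q <- t)
    (p.1 * q.1) ⊗ hodge (comp k p.2 * hodge (comp k q.2))); last first.
  rewrite exchange_big; apply: eq_bigr => p _.
  rewrite exchange_big; apply: eq_bigr => q _.
  by rewrite tens_sumr.
apply: eq_bigr => k _.
rewrite (rho_hodge (pairing_terms f z _)) // rhoM.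
rewrite (rho_hodge (component_deg hdeg k z)) !rho_comp hs ht.
have cl := component_linear hdeg k.
have e1 : tmap id (comp k) (\sum_(p <- s) p.1 ⊗ p.2)
    = \sum_(p <- [seq (p.1, comp k p.2) | p <- s]) p.1 ⊗ p.2.
  by rewrite tmap_sum // big_map.
have e2 : tmap id hodge (tmap id (comp k) (\sum_(q <- t) q.1 ⊗ q.2))
    = \sum_(q <- [seq (q.1, hodge (comp k q.2)) | q <- t]) q.1 ⊗ q.2.
  rewrite (tmap_sum cl) big_map.
  have := tmap_sum hodge_linear [seq (q.1, comp k q.2) | q <- t].
  by rewrite !big_map.
rewrite e1 e2 tmul_sum.
rewrite (linear_bigsum (tmap_linear hodge_linear)) big_map; apply: eq_bigr => p _.
rewrite (linear_bigsum (tmap_linear hodge_linear)) big_map; apply: eq_bigr => q _.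
by rewrite tmap_tens //; apply: hodge_linear.
Qed.

End Lefschetz.
(** * The Hermitian module of a positive definite Hermitian structure *)
Section FormPairing.
Context {R : realType}.
Local Notation C := R[i].
Context {A : algType C} {Delta : A -> A ⊗ A} {eps : A -> C} {S starA : A -> A}.
Hypothesis hA : hopf_star_algebra Delta eps S starA.
Context {P : {pred A}} {B : subAlgType P} {DeltaB : B -> (A ⊗ B)%type}.
Hypothesis hB : quantum_homogeneous_space Delta eps DeltaB.
Context {starB : B -> B}.
Hypothesis hstarB : forall b, val (starB b) = starA (val b).
Context {Om : algType C} {deg : nat -> set Om} {j : {lrmorphism B -> Om}}.
Context {d star : Om -> Om} {rho : Om -> (A ⊗ Om)%type}.
Hypothesis hcalc : differential_calculus deg j d.
Hypothesis hstar : star_calculus starB deg j d star.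
Hypothesis hcov : covariant_calculus Delta eps DeltaB j d rho.
Hypothesis hmod0 : mod0_object Delta eps S DeltaB
  (fun b w => j b * w) (fun w b => w * j b) rho.
Context {n : nat}.
Hypothesis hdeg : total_degree deg (2 * n).
Context {bideg : nat -> nat -> set Om} {sigma : Om}.
Hypothesis hherm : hermitian_structure deg d star bideg n sigma.
Hypothesis hhermcov : covariant_hermitian_structure rho bideg sigma.

Let hH := hsa_hopf hA.
Let hgr := dc_grading hcalc.
Let hM := dc_mul hcalc.
Let hV := hdeg.2.
Let hinv := sc_conj_inv hstar.
Let hsM := sc_mul hstar.
Let hrho := cc_comodule hcov.

Local Notation pairing := (@pairing R Om deg bideg n sigma).

Definition form_pairing (f z : Om) : B := metric deg j star bideg n sigma f (star z).
Local Notation tau := form_pairing.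

Lemma j_deg0 b : deg 0%N (j b).
Proof. by rewrite (dc_deg0 hcalc); exists b. Qed.

Lemma form_pairingE f z : j (tau f z) = pairing f z.
Proof.
have e : \sum_(k < (2 * n).+1) hodge bideg n sigma (component deg k f *
      hodge bideg n sigma (star (component deg k (star z)))) = pairing f z.
  apply: eq_bigr => k _.
  by rewrite (comp_star hgr hV hherm hinv) (conj_inv_invol hinv).
have := pairing_deg0 hgr hM hV hherm f z; rewrite (dc_deg0 hcalc) => -[b _ hb].
rewrite /form_pairing /metric e -hb (@xget_unique _ _ _ b) //=.
by move=> b' /(dc_j_inj hcalc).
Qed.

Lemma form_pairingDl f f' z : tau (f + f') z = tau f z + tau f' z.
Proof.
by apply: (dc_j_inj hcalc); rewrite rmorphD /= !form_pairingE (pairingDl hgr hM hV hherm).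
Qed.

Lemma form_pairingDr f z z' : tau f (z + z') = tau f z + tau f z'.
Proof.
by apply: (dc_j_inj hcalc); rewrite rmorphD /= !form_pairingE (pairingDr hgr hM hV hherm).
Qed.

Lemma form_pairingMl b f z : tau (j b * f) z = b * tau f z.
Proof.
apply: (dc_j_inj hcalc); rewrite rmorphM /= !form_pairingE.
by rewrite (pairing_mull hgr hM hV hherm) //; apply: j_deg0.
Qed.

Lemma form_pairingMr f z b : tau f (z * j b) = tau f z * b.
Proof.
apply: (dc_j_inj hcalc); rewrite rmorphM /= !form_pairingE.
by rewrite (pairing_mulr hgr hM hV hherm) //; apply: j_deg0.
Qed.

Lemma form_pairingMm f b z : tau (f * j b) z = tau f (j b * z).
Proof.
apply: (dc_j_inj hcalc); rewrite !form_pairingE.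
by rewrite (pairing_balanced hgr hM hV hherm) //; apply: j_deg0.
Qed.

Lemma form_pairing_star f z : tau f z = starB (tau (star z) (star f)).
Proof.
apply: (dc_j_inj hcalc); rewrite -(sc_ext hstar) !form_pairingE.
exact: (pairing_star hgr hM hV hherm hinv hsM).
Qed.

(** eps on degree 0, extended by zero to a linear functional on all forms, so
    that it can be applied to the second leg of a coaction. *)
Definition deg0_functional (w : Om) : C :=
  eps (val (xget 0 [set b | j b = component deg 0%N w])).

Lemma deg0_functional_eq w b :
  component deg 0%N w = j b -> deg0_functional w = eps (val b).
Proof.
move=> e; rewrite /deg0_functional (@xget_unique _ _ _ b) //= => b'.
by rewrite e => /(dc_j_inj hcalc).
Qed.

Lemma deg0_functional_linear : linear (deg0_functional : Om -> C^o).
Proof.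
have ex w : exists b, component deg 0%N w = j b.
  by have := component_deg hgr 0%N w; rewrite (dc_deg0 hcalc) => -[b _ <-]; exists b.
move=> c x y; have [bx ex'] := ex x; have [bY ey] := ex y.
rewrite (deg0_functional_eq ex') (deg0_functional_eq ey).
rewrite (@deg0_functional_eq _ (c *: bx + bY)) ?linearP ?(eps_linear hH) //.
by rewrite (component_linear hgr) ex' ey.
Qed.

Lemma deg0_functional_j b : deg0_functional (j b) = eps (val b).
Proof. by apply: deg0_functional_eq; rewrite (component_id hgr) //; apply: j_deg0. Qed.

(** The counit applied to the second leg of the coaction of the degree 0 form
    j (tau f z), computed in two ways: in the coideal subalgebra it returns
    the element itself, and [rho_pairing] gives the other side. *)
Lemma form_pairing_cov f z : val (tau f z) =
  tlift (fun a f0 => tlift (fun c z0 =>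
    eps (val (tau f0 z0)) *: (a * c)) (rho z)) (rho f).
Proof.
have fL := deg0_functional_linear.
pose G := tlift (fun (a : A) w => deg0_functional w *: a).
have hG : cbalanced (fun (a : A) w => deg0_functional w *: a).
  apply: bilinear_balanced => [w|v] k x y.
    by rewrite scalerDr !scalerA [_ * k]mulrC.
  by rewrite fL scalerDl scalerA.
have hE : cbalanced (fun (a a' : A) => eps a' *: a).
  apply: bilinear_balanced => [w|v] k x y.
    by rewrite scalerDr !scalerA [_ * k]mulrC.
  by rewrite (eps_linear hH) scalerDl scalerA.
transitivity (G (rho (j (tau f z)))).
  rewrite (cc_ext hcov) /G /tmap (tlift_comp _ _ hG).
  rewrite -[LHS](counit_r hH) -(qhs_coideal hB) /tmap (tlift_comp _ _ hE).
  by apply: eq_tlift => a b; rewrite !tliftE // deg0_functional_j.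
rewrite form_pairingE.
rewrite (rho_pairing hgr hM hV hherm (rho_linear hrho) (cc_mul hcov)
  (chs_complex hhermcov) (chs_sigma hhermcov)).
rewrite /G (tlift_comp _ _ hG); apply: eq_tlift => a f0.
rewrite (tlift_comp _ _ hG); apply: eq_tlift => c z0.
by rewrite tliftE // -form_pairingE deg0_functional_j.
Qed.

Lemma starO_mul b w : star (j b * w) = star w * j (starB b).
Proof.
have sD := starD hinv; have s0 := star0 hinv.
rewrite (comp_sum hgr hV w) mulr_sumr !(big_morph _ sD s0) mulr_suml.
apply: eq_bigr => k _.
by rewrite (hsM (j_deg0 b) (component_deg hgr _ _)) mul0n expr0 scale1r (sc_ext hstar).
Qed.

Lemma starB_invol : involutive starB.
Proof.
move=> b; apply: val_inj; rewrite !hstarB.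
exact: (conj_inv_invol (star_conj_inv (hsa_star hA))).
Qed.

Hypothesis hpos : positive_definite starB deg j star bideg n sigma.

Lemma form_frame : exists s : seq (Om * Om),
  forall z, z = \sum_(p <- s) p.2 * j (tau p.1 z).
Proof.
apply: (tau_frame hA (qhs_flat hB) hrho (rhm_fin_gen (mod0_rhm hmod0))
  (mod0_ract hmod0) hinv starO_mul form_pairingDl form_pairingDr form_pairingMl
  form_pairingMr form_pairingMm _ form_pairing_cov) => [f z|f h0].
  by rewrite {1}form_pairing_star hstarB.
apply/eqP/negPn/negP => /hpos[/eqP ne _]; apply: ne.
by rewrite -h0 /form_pairing (conj_inv_invol hinv).
Qed.

Local Notation M := (restr_mod j).
Local Notation h := (h_sigma deg (j := j) star bideg n sigma).

Lemma h_sigmaE (k f : M) : h k f = tau f (star k).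
Proof. by rewrite /form_pairing (conj_inv_invol hinv). Qed.

Lemma h_sigma_linear (k : M) : linear (h k : M -> B^o).
Proof.
move=> b f f'; rewrite !h_sigmaE form_pairingDl.
by rewrite -[b *: f]/(j b * (f : Om)) form_pairingMl.
Qed.

Lemma h_sigma_additive (k k' f : M) : h (k + k') f = h k f + h k' f.
Proof. by rewrite !h_sigmaE (starD hinv) form_pairingDr. Qed.

Lemma h_sigma_right (k : M) b f : h (starB b *: k) f = h k f * b.
Proof.
rewrite !h_sigmaE -[starB b *: k]/(j (starB b) * (k : Om)) starO_mul starB_invol.
exact: form_pairingMr.
Qed.

(** The star of the frame of [form_frame], as g(f, x) is tau(f, star x). *)
Lemma h_sigma_frame : exists s : seq (Om * Om),
  forall f : M, f = \sum_(p <- s) h (p.1 : M) f *: (p.2 : M).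
Proof.
have [s hs] := form_frame.
exists [seq (p.1, star p.2) | p <- s] => f.
rewrite big_map -[LHS](conj_inv_invol hinv) [star f]hs.
rewrite (big_morph _ (starD hinv) (star0 hinv)); apply: eq_bigr => p _ /=.
rewrite h_sigmaE -[RHS]/(j (tau f (star p.1)) * star p.2).
rewrite [tau f _]form_pairing_star -[RHS](conj_inv_invol hinv) starO_mul.
by rewrite starB_invol !(conj_inv_invol hinv).
Qed.

Lemma h_sigma_projective : projective M.
Proof.
move=> M' N p u pS; have [s hs] := h_sigma_frame.
have [g hg] := boolp.choice pS.
pose v (f : M) := \sum_(q <- s) h (q.1 : M) f *: g (u (q.2 : M)).
have vL : linear v.
  move=> b f f'; rewrite /v scaler_sumr -big_split; apply: eq_bigr => q _.
  by rewrite h_sigma_linear scalerDl scalerA.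
exists (linear_of vL) => f; rewrite /= /v linear_sum [in RHS](hs f) linear_sum.
by apply: eq_bigr => q _; rewrite !linearZ /= hg.
Qed.

(** Injectivity is positivity of g on a difference; a functional phi is
    represented by sum_q starB (phi y_q) x_q for the frame (x_q, y_q). *)
Lemma h_sigma_bij : set_bij [set: M] (@dual B M) h.
Proof.
split.
- by move=> k _; apply: h_sigma_linear.
- move=> k k' _ _ e; apply/eqP; rewrite -subr_eq0; apply/negPn/negP => /hpos[/eqP ne _].
  apply: ne; have hL f : h (k - k' : M) f = h k f - h k' f.
    by apply/eqP; rewrite eq_sym subr_eq -h_sigma_additive subrK.
  by rewrite -[LHS]/(h (k - k' : M) (k - k' : M)) hL e subrr.
- move=> phi hphi; have [s hs] := h_sigma_frame.
  exists (\sum_(q <- s) starB (phi (q.2 : M)) *: (q.1 : M)) => //.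
  apply/funext => f; rewrite [in RHS](hs f).
  rewrite (linear_bigsum (hphi : linear (phi : M -> B^o))).
  have h0 : h 0 f = 0 by apply: (addrI (h 0 f)); rewrite -h_sigma_additive !addr0.
  rewrite (big_morph (h^~ f) (fun k k' => h_sigma_additive k k' f) h0).
  apply: eq_bigr => q _.
  by rewrite h_sigma_right (linear_scale (hphi : linear (phi : M -> B^o))).
Qed.

End FormPairing.

Theorem corollary4p3 (R : realType)
  (A : algType R[i]) (Delta : A -> A ⊗ A) (eps : A -> R[i]) (S starA : A -> A)
  (hA : hopf_star_algebra Delta eps S starA)
  (P : {pred A}) (B : subAlgType P) (DeltaB : B -> A ⊗ B)
  (hB : quantum_homogeneous_space Delta eps DeltaB)
  (starB : B -> B) (hstarB : forall b, val (starB b) = starA (val b))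
  (Om : algType R[i]) (deg : nat -> set Om) (j : {lrmorphism B -> Om})
  (d starO : Om -> Om) (rho : Om -> A ⊗ Om)
  (hcalc : differential_calculus deg j d)
  (hstar : star_calculus starB deg j d starO)
  (hcov : covariant_calculus Delta eps DeltaB j d rho)
  (hmod0 : mod0_object Delta eps S DeltaB
             (fun b w => j b * w) (fun w b => w * j b) rho)
  (n : nat) (hdeg : total_degree deg (2 * n))
  (bideg : nat -> nat -> set Om) (sigma : Om)
  (hherm : hermitian_structure deg d starO bideg n sigma)
  (hhermcov : covariant_hermitian_structure rho bideg sigma)
  (hpos : positive_definite starB deg j starO bideg n sigma) :
  hermitian_module starB (h_sigma deg (j := j) starO bideg n sigma).
Proof.
have hinv := sc_conj_inv hstar.
split.
- exact: rhm_fin_gen (mod0_rhm hmod0).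
- exact: (h_sigma_projective hA hB hstarB hcalc hstar hcov hmod0 hdeg hherm
    hhermcov hpos).
- exact: (h_sigma_bij hA hB hstarB hcalc hstar hcov hmod0 hdeg hherm
    hhermcov hpos).
- exact: (h_sigma_additive hcalc hstar hdeg hherm).
- exact: (h_sigma_right hA hstarB hcalc hstar hdeg hherm).
- move=> f k; rewrite !(h_sigmaE hstar).
  rewrite (form_pairing_star hcalc hstar hdeg hherm).
  by rewrite (conj_inv_invol hinv).
- by move=> f; apply: hpos.
Qed.
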